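(* Let $M$ be a compact oriented $5$-manifold and let $\rho=(\rho_1,\rho_2)\in\Omega^{ev}(M)\otimes\mathbf R^2$ be an $\mathbf R^2$-valued even form lying at each point in an open orbit, satisfying $d\rho=0=d\hat\rho$. Then $\rho$ gives three Courant-commuting sections of $T\oplus T^*$ whose inner products are constant: the (linearly independent) sections $v_1,h,v_2$ of $T\oplus T^*$ defined by $$Q(\rho_1+z\rho_2)=\phi(\rho)\otimes(v_1+2zh+z^2v_2)\quad\text{for all }z$$ have pairwise vanishing Courant brackets, and all the functions $(v,w)$ with $v,w\in\{v_1,h,v_2\}$ are constant.
   Context: $T\oplus T^*$ has the inner product with $(X+\xi,X+\xi)=i_X\xi$ (so $(X+\xi,Y+\eta)=\frac12(i_X\eta+i_Y\xi)$) and acts on forms by Clifford multiplication $(X+\xi)\cdot\varphi=i_X\varphi+\xi\wedge\varphi$. The Courant bracket is $[X+\xi,Y+\eta]=[X,Y]+\mathcal L_X\eta-\mathcal L_Y\xi-\frac12d(i_X\eta-i_Y\xi)$; sections Courant-commute if their Courant bracket is zero. The half-spin spaces of $Spin(T\oplus T^* )\cong Spin(5,5)$ are $S=\Lambda^{ev}T^*$ and $S^*=\Lambda^{od}T^*$, with the Mukai pairing $\langle\varphi_1,\varphi_2\rangle=[\varphi_1\wedge\sigma(\varphi_2)]_5\in\Lambda^5T^*$, where $\sigma(\alpha)=(-1)^m\alpha$ for $\alpha$ of degree $2m$ or $2m+1$. For even forms $\varphi$, $Q(\varphi)\in\Lambda^5T^*\otimes(T\oplus T^* )$ is defined by $(Q(\varphi),v)=\langle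 v\cdot\varphi,\varphi\rangle$ for all $v\in T\oplus T^*$. For $\rho=(\rho_1,\rho_2)\in\Lambda^{ev}T^*\otimes\mathbf R^2$ put $f(\rho)=(Q(\rho_1),Q(\rho_2))\in(\Lambda^5T^* )^2$. The group $Spin(5,5)\times GL(2,\mathbf R)$ acts on $\Lambda^{ev}T^*\otimes\mathbf R^2$ at each point with open orbits, on which $f\neq0$. There $\phi(\rho)=|f(\rho)|^{1/2}$ is the positive volume form (with respect to the orientation). The form $\hat\rho=(\hat\rho_1,\hat\rho_2)\in\Omega^{od}(M)\otimes\mathbf R^2$ is defined by the derivative of $\phi$ at $\rho$: $D\phi(\dot\rho)=\langle\hat\rho_2,\dot\rho_1\rangle-\langle\hat\rho_1,\dot\rho_2\rangle$ for all $\dot\rho$. The equations $d\rho=0=d\hat\rho$ are the critical point equations for $\int_M\phi(\rho)$ on a cohomology class in $H^{ev}(M,\mathbf R^2)$.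
   Formalization: ''Constant'' is stated as constant on each connected component of M (plain constancy when M is connected); on a disconnected M such as two disjoint 5-tori the sign of (v_1,v_2)=±1 can differ between components, so global constancy fails there. *)

(* Defs.v *)
(* MathComp-Analysis: the reals are an arbitrary [R : realType]. *)
From HB Require Import structures.
From mathcomp Require Import all_boot all_order all_algebra.
From mathcomp Require Import all_classical all_reals all_analysis.

Set Implicit Arguments.
Unset Strict Implicit.
Unset Printing Implicit Defensive.

Import Order.TTheory GRing.Theory Num.Theory.
Import numFieldNormedType.Exports.

Local Open Scope ring_scope.

Section ExteriorAlgebra.
Context {R : realType} {n : nat}.

(* Lambda^* of the dual of R^n.  The coefficient [coef a A] is that of
   dx_A = dx_a1 /\ ... /\ dx_ak with A = {a1 < ... < ak}; coefficients are
   stored in a row vector so that the library's normed structure applies. *)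
Definition form : Type := 'rV[R]_#|{: {set 'I_n}}|.

Definition coef (a : form) (A : {set 'I_n}) : R := a ord0 (enum_rank A).

Definition mkform (c : {set 'I_n} -> R) : form := \row_k c (enum_val k).

Definition inversions (A B : {set 'I_n}) : nat :=
  #|[set p : 'I_n * 'I_n | [&& p.1 \in A, p.2 \in B & (p.2 < p.1)%N]]|.

Definition wedge (a b : form) : form :=
  mkform (fun C => \sum_(A : {set 'I_n} | A \subset C)
    (-1) ^+ inversions A (C :\: A) * coef a A * coef b (C :\: A)).

Definition one_form0 : form := mkform (fun A => (A == finset.set0)%:R).

Definition covec (xi : 'rV[R]_n) : form :=
  mkform (fun A => \sum_i xi 0 i * (A == [set i])%:R).

Definition contract (X : 'rV[R]_n) (a : form) : form :=
  mkform (fun A => \sum_(i | i \notin A)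
    (-1) ^+ inversions [set i] A * X 0 i * coef a (i |: A)).

Definition is_even (a : form) : Prop := forall A : {set 'I_n}, odd #|A| -> coef a A = 0.
Definition is_odd (a : form) : Prop := forall A : {set 'I_n}, ~~ odd #|A| -> coef a A = 0.

(* Pull-back by the linear map v |-> v *m J; it sends dx_l to the l-th column
   of J. *)
Definition pullback (J : 'M[R]_n) (a : form) : form :=
  \sum_(A : {set 'I_n})
    coef a A *: \big[wedge/one_form0]_(l <- enum A) covec (col l J)^T.

(* Lambda^n is identified with R by dx_1 /\ ... /\ dx_n. *)
Definition top (a : form) : R := coef a [set: 'I_n].

Definition sigma (a : form) : form :=
  mkform (fun A => (-1) ^+ (#|A|./2) * coef a A).

Definition mukai (a b : form) : R := top (wedge a (sigma b)).

(* T + T^* at a point; (X, xi) stands for X + xi. *)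
Definition gvec : Type := ('rV[R]_n * 'rV[R]_n)%type.

Definition pairing (X xi : 'rV[R]_n) : R := \sum_i X 0 i * xi 0 i.

Definition ip (u v : gvec) : R :=
  2%:R^-1 * (pairing u.1 v.2 + pairing v.1 u.2).

Definition cliff (v : gvec) (a : form) : form :=
  contract v.1 a + wedge (covec v.2) a.

Definition basis_vec (i : 'I_n) : 'rV[R]_n := delta_mx 0 i.

(* The factor 2 is due to ip (e_i, 0) (0, e_i) = 1/2; the characterization by
   the inner product is [QE]. *)
Definition Q (a : form) : gvec :=
  (\row_i (2%:R * mukai (cliff (0, basis_vec i) a) a),
   \row_i (2%:R * mukai (cliff (basis_vec i, 0) a) a)).

Definition fquartic (rho : form * form) : R := ip (Q rho.1) (Q rho.2).

(* Coefficient of the positive volume form phi(rho) in an oriented frame. *)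
Definition phi (rho : form * form) : R := Num.sqrt `|fquartic rho|.

Definition is_even2 (rho : form * form) : Prop :=
  is_even rho.1 /\ is_even rho.2.

(* rhat is determined by the derivative of phi at rho, in even directions. *)
Definition is_hat (rho rhat : form * form) : Prop :=
  [/\ is_odd rhat.1, is_odd rhat.2, differentiable phi rho &
      forall s : form * form, is_even2 s ->
        'd phi rho s = mukai rhat.2 s.1 - mukai rhat.1 s.2].

(* An element of Spin(n, n) is a product of an even number of vectors of
   square 1 or -1 in the Clifford algebra. *)
Definition spin_word (s : seq gvec) : Prop :=
  ~~ odd (size s) /\ {in s, forall v, ip v v = 1 \/ ip v v = -1}.

Definition spin_act (s : seq gvec) (a : form) : form := foldr cliff a s.

Definition gl2_act (g : 'M[R]_2) (rho : form * form) : form * form :=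
  (g 0 0 *: rho.1 + g 0 1 *: rho.2, g 1 0 *: rho.1 + g 1 1 *: rho.2).

Definition orbit_of (rho : form * form) : set (form * form) :=
  [set r | exists s g, [/\ spin_word s, g \in unitmx &
     r = gl2_act g (spin_act s rho.1, spin_act s rho.2)]]%classic.

(* Open as a subset of the even part Lambda^ev * R^2. *)
Definition in_open_orbit (rho : form * form) : Prop :=
  exists2 O : set (form * form), open O &
    orbit_of rho = (O `&` [set r | is_even2 r])%classic.

End ExteriorAlgebra.

Arguments form : clear implicits.
Arguments gvec : clear implicits.

Section QCharacterization.
Context {R : realType} {n : nat}.
Implicit Types (a b : form R n) (v : gvec R n).

Lemma coef_mkform (c : {set 'I_n} -> R) A : coef (mkform c) A = c A.
Proof. by rewrite /coef mxE enum_rankK. Qed.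

Lemma coefD a b A : coef (a + b) A = coef a A + coef b A.
Proof. by rewrite /coef mxE. Qed.

Let mukaiE a b : mukai a b =
  \sum_(A : {set 'I_n}) (-1) ^+ inversions A (~: A) * coef a A *
    coef (sigma b) (~: A).
Proof.
rewrite /mukai /top coef_mkform; apply: eq_big => [A|A _]; first exact: finset.subsetT.
by rewrite finset.setTD.
Qed.

Let coef_cliff v a A : coef (cliff v a) A =
  \sum_i (v.1 0 i * coef (cliff (basis_vec i, 0) a) A +
          v.2 0 i * coef (cliff (0, basis_vec i) a) A).
Proof.
rewrite big_split /= coefD; congr (_ + _).
- rewrite coef_mkform big_mkcond /=; apply: eq_bigr => i _.
  rewrite coefD !coef_mkform [X in _ * (_ + X)](_ : _ = 0) ?addr0; last first.
    rewrite big1 // => B _.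
    by rewrite coef_mkform big1 ?mulr0 ?mul0r // => j _; rewrite mxE mul0r.
  case: ifPn => iA.
    rewrite (bigD1 i) //= [X in _ + X]big1 ?addr0.
      by rewrite !mxE !eqxx mulr1 mulrCA mulrA.
    by move=> j /andP[_ ji]; rewrite !mxE (negbTE ji) andbF mulr0 mul0r.
  rewrite big1 ?mulr0 // => j jA; rewrite !mxE eqxx /=.
  by rewrite (_ : (j == i) = false) ?mulr0 ?mul0r //;
    apply: contraNF iA => /eqP <-.
- rewrite coef_mkform.
  transitivity (\sum_i \sum_(B : {set 'I_n} | B \subset A)
     v.2 0 i * ((-1) ^+ inversions B (A :\: B) * (B == [set i])%:R *
       coef a (A :\: B))).
    rewrite exchange_big /=; apply: eq_bigr => B _; rewrite coef_mkform.
    rewrite mulr_sumr mulr_suml; apply: eq_bigr => i _.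
    by rewrite mulrCA !mulrA.
  apply: eq_bigr => i _; rewrite -mulr_sumr; congr (_ * _).
  rewrite coefD !coef_mkform [X in _ = X + _](_ : _ = 0) ?add0r; last first.
    by rewrite big1 // => j _; rewrite mxE mulr0 mul0r.
  apply: eq_bigr => B _; rewrite coef_mkform; congr (_ * _ * _).
  rewrite (bigD1 i) //= big1 ?addr0 ?mxE ?eqxx ?mul1r // => j ji.
  by rewrite mxE (negbTE ji) andbF mul0r.
Qed.

Lemma QE a v : ip (Q a) v = mukai (cliff v a) a.
Proof.
have two0 : (2%:R : R) != 0 by rewrite pnatr_eq0.
have -> : mukai (cliff v a) a =
  \sum_i (v.1 0 i * mukai (cliff (basis_vec i, 0) a) a +
          v.2 0 i * mukai (cliff (0, basis_vec i) a) a).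
  transitivity (\sum_i \sum_(A : {set 'I_n})
     (-1) ^+ inversions A (~: A) *
     (v.1 0 i * coef (cliff (basis_vec i, 0) a) A +
      v.2 0 i * coef (cliff (0, basis_vec i) a) A) * coef (sigma a) (~: A)).
    rewrite exchange_big /= mukaiE; apply: eq_bigr => A _.
    by rewrite coef_cliff mulr_sumr mulr_suml.
  apply: eq_bigr => i _; rewrite !mukaiE !mulr_sumr -big_split /=.
  apply: eq_bigr => A _.
  by rewrite mulrDr mulrDl; congr (_ + _); rewrite mulrCA !mulrA.
rewrite /ip /pairing -big_split mulr_sumr /=; apply: eq_bigr => i _.
rewrite !mxE addrC [v.1 0 i * _]mulrCA -[2%:R * _ * _]mulrA -mulrDr mulrA.
by rewrite mulVf // mul1r; congr (_ + _); rewrite mulrC.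
Qed.

End QCharacterization.

Section LocalCalculus.
Context {R : realType} {n : nat}.

Definition partial {V : normedModType R} (i : 'I_n) (f : 'rV[R]_n -> V) :
  'rV[R]_n -> V := fun x => 'D_(basis_vec i) f x.

Fixpoint Ck {V : normedModType R} (k : nat) (U : set 'rV[R]_n)
    (f : 'rV[R]_n -> V) : Prop :=
  (forall x, U x -> {for x, continuous f}) /\
  if k is k'.+1 then
    forall i, (forall x, U x -> derivable f x (basis_vec i)) /\
              Ck k' U (partial i f)
  else True.

Definition smooth {V : normedModType R} (U : set 'rV[R]_n)
    (f : 'rV[R]_n -> V) : Prop := forall k, Ck k U f.

Definition ext_d (a : 'rV[R]_n -> form R n) (x : 'rV[R]_n) : form R n :=
  \sum_i wedge (covec (basis_vec i)) (partial i a x).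

Definition grad (f : 'rV[R]_n -> R) (x : 'rV[R]_n) : 'rV[R]_n :=
  \row_i partial i f x.

Definition lie_bracket (X Y : 'rV[R]_n -> 'rV[R]_n) (x : 'rV[R]_n) :
    'rV[R]_n :=
  \sum_j (X x 0 j *: partial j Y x - Y x 0 j *: partial j X x).

(* d i_X + i_X d on 1-forms, in coordinates. *)
Definition lie_form (X eta : 'rV[R]_n -> 'rV[R]_n) (x : 'rV[R]_n) :
    'rV[R]_n :=
  \row_i \sum_j (X x 0 j * partial j eta x 0 i + eta x 0 j * partial i X x 0 j).

Definition courant (u v : 'rV[R]_n -> gvec R n) (x : 'rV[R]_n) : gvec R n :=
  let X y := (u y).1 in let xi y := (u y).2 in
  let Y y := (v y).1 in let eta y := (v y).2 in
  (lie_bracket X Y x,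
   lie_form X eta x - lie_form Y xi x
   - 2%:R^-1 *: grad (fun y => pairing (X y) (eta y) - pairing (Y y) (xi y)) x).

End LocalCalculus.

(* [coord_inv i] is a total function, meaningful only on the open set
   [cimage i]. *)
Record manifold (R : realType) (n : nat) := Manifold {
  carrier :> topologicalType;
  carrier_hausdorff : hausdorff_space carrier;
  carrier_second_countable : @second_countable carrier;
  chart : Type;
  dom : chart -> set carrier;
  coord : chart -> carrier -> 'rV[R]_n;
  coord_inv : chart -> 'rV[R]_n -> carrier;
  cimage := fun i => (coord i @` dom i)%classic;
  overlap := fun i j => (coord i @` (dom i `&` dom j))%classic;
  transition := fun i j x => coord j (coord_inv i x);
  dom_open : forall i, open (dom i);
  cimage_open : forall i, open (cimage i);
  coordK : forall i p, dom i p -> coord_inv i (coord i p) = p;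
  coord_continuous : forall i p, dom i p -> {for p, continuous (coord i)};
  coord_inv_continuous :
    forall i x, cimage i x -> {for x, continuous (coord_inv i)};
  dom_cover : forall p, exists i, dom i p;
  transition_smooth : forall i j, smooth (overlap i j) (transition i j)
}.

Section Manifolds.
Context {R : realType} {n : nat}.
Implicit Types M : manifold R n.

(* Jacobian for row vectors: its (k, l) entry is d(x_j)_l / d(x_i)_k. *)
Definition jac M (i j : chart M) (x : 'rV[R]_n) : 'M[R]_n :=
  \matrix_(k, l) partial k (transition i j) x 0 l.

(* The given atlas is an oriented one. *)
Definition oriented M : Prop :=
  forall (i j : chart M) x, overlap i j x -> 0 < \det (jac i j x).

(* A form on M, by its expressions in the charts; values outside
   [cimage i] are irrelevant. *)
Record form_field M := FormField {
  form_at :> chart M -> 'rV[R]_n -> form R n;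
  form_smooth : forall i, smooth (cimage i) (form_at i);
  form_change : forall i j x, overlap i j x ->
    form_at i x = pullback (jac i j x) (form_at j (transition i j x))
}.

(* Like [form_field]; vector parts are pushed forward and covector parts pulled
   back by changes of charts. *)
Record gsection M := GSection {
  gvec_at :> chart M -> 'rV[R]_n -> gvec R n;
  gvec_smooth : forall i, smooth (cimage i) (gvec_at i);
  gvec_change1 : forall i j x, overlap i j x ->
    (gvec_at j (transition i j x)).1 = (gvec_at i x).1 *m jac i j x;
  gvec_change2 : forall i j x, overlap i j x ->
    (gvec_at i x).2 = (gvec_at j (transition i j x)).2 *m (jac i j x)^T
}.

Definition pointwise M (P : chart M -> 'rV[R]_n -> Prop) : Prop :=
  forall i x, cimage i x -> P i x.

Definition closed_form M (a : form_field M) : Prop :=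
  pointwise (fun (i : chart M) x => ext_d (a i) x = 0).

Definition generated_by M (rho1 rho2 : form_field M) (v1 h v2 : gsection M) :
    Prop :=
  pointwise (fun (i : chart M) x => forall z : R,
    Q (rho1 i x + z *: rho2 i x) =
    phi (rho1 i x, rho2 i x) *:
      (v1 i x + (2%:R * z) *: h i x + z ^+ 2 *: v2 i x)).

Definition independent M (v1 h v2 : gsection M) : Prop :=
  pointwise (fun (i : chart M) x => free [:: v1 i x; h i x; v2 i x]).

Definition courant_commute M (v w : gsection M) : Prop :=
  pointwise (fun (i : chart M) x => courant (v i) (w i) x = 0).

(* The function (v, w) on M is constant on each connected component of M,
   i.e. constant when M is connected. *)
Definition constant_ip M (v w : gsection M) : Prop :=
  forall (i j : chart M) (p q : M), dom i p -> dom j q ->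
    connected_component [set: M]%classic p q ->
    ip (v i (coord i p)) (w i (coord i p)) =
    ip (v j (coord j q)) (w j (coord j q)).

End Manifolds.

(* Main.v *)
Require Import Defs.
From mathcomp Require Import all_boot all_order all_algebra.
From mathcomp Require Import all_classical all_reals all_analysis.
From mathcomp Require Import ring lra zify.

(* On even forms in dimension 5, Q a is null and Q(a) . a = 0.  Polarizing along
   rho_1 + z rho_2 gives the Gram matrix of v_1, h, v_2 in terms of the sign e of
   f(rho): (v_1, v_2) = e, (h, h) = - e / 2 and all the others vanish; moreover
   v_1 . rho_1 = v_2 . rho_2 = 0, v_1 . rho_2 = - 2 h . rho_1 and
   v_2 . rho_1 = - 2 h . rho_2.  Differentiating phi^2 = |f| yields
   rhat_1 = - e v_1 . rho_2 and rhat_2 = e v_2 . rho_1.  Hence u . rho_i is closed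
   for u in {v_1, h, v_2}, and so are the relevant u . w . rho_i, which are locally
   constant multiples of rho_1 and rho_2.  The derived bracket formula
   [[d, u], w] = [u, w] then shows that the Dorfman bracket of u and w annihilates
   both rho_1 and rho_2, so it vanishes because f(rho) <> 0; it differs from the
   Courant bracket by d(u, w) = 0. *)

(** An open orbit is exploited through f <> 0: the group multiplies f by nonzero factors only, so f
    = 0 at one point would make f vanish on an open set of even pairs, whereas f is a polynomial
    that is nonzero at an explicit pair. The nullity of Q a is the one identity checked by brute
    force, on the sixteen coefficients of an even form in dimension 5; the algebraic relations
    between v_1, h, v_2 and rho follow from it by polarization.

    The orientation is what makes v_1, h, v_2 global: under pull-back by J, Q is multiplied by det J
    and phi by |det J|, so the quotient transforms as a section of T + T^* when det J > 0. The sign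
    e of f is only locally constant, hence every closedness argument is made near a point, and inner
    products are compared along connected components. The Dorfman bracket is preferred to the
    Courant bracket for computing because it acts on forms as an iterated commutator with d, without
    correction terms. *)

Section Development.
Set Implicit Arguments.
Unset Strict Implicit.
Unset Printing Implicit Defensive.
(* [Defs] is imported again because mathcomp shadows some of its names. *)
Import Order.TTheory GRing.Theory Num.Theory numFieldNormedType.Exports Defs.
Local Open Scope ring_scope.

(** * The Clifford action *)

Section CliffordAlgebra.
Context {R : realType} {n : nat}.
Implicit Types (a b c : form R n) (u v w : gvec R n) (A B : {set 'I_n}) (i j : 'I_n).

Lemma coef_inj a b : (forall A, coef a A = coef b A) -> a = b.
Proof.
move=> ab; apply/rowP => k; have := ab (enum_val k).
by rewrite /coef enum_valK.
Qed.

Lemma coef_formZ k a A : coef (k *: a) A = k * coef a A.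
Proof. by rewrite /coef mxE. Qed.

Lemma coef_form0 A : coef (0 : form R n) A = 0.
Proof. by rewrite /coef mxE. Qed.

Lemma coef_form_sum (I : Type) (r : seq I) (P : pred I) (F : I -> form R n) A :
  coef (\sum_(i <- r | P i) F i) A = \sum_(i <- r | P i) coef (F i) A.
Proof. by rewrite /coef summxE. Qed.

(** Contraction with e_i and multiplication by dx_i both toggle i in the index set, so a single
    involution describes the two actions. *)
Definition flip i A : {set 'I_n} := if i \in A then A :\ i else i |: A.

Definition below i A : nat := #|[set j in A | (j < i)%N]|.

Lemma in_flip i A j : (j \in flip i A) = (j == i) (+) (j \in A).
Proof.
rewrite /flip; case: (boolP (i \in A)) => iA; rewrite !inE;
  by case: (eqVneq j i) => [->|] //=; rewrite ?iA ?(negbTE iA).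
Qed.

Lemma flipK i : involutive (flip i).
Proof. by move=> A; apply/finset.setP => j; rewrite !in_flip addbA addbb. Qed.

Lemma flipC i j A : flip i (flip j A) = flip j (flip i A).
Proof. by apply/finset.setP => k; rewrite !in_flip addbCA. Qed.

Lemma flip_setC i A : ~: flip i A = flip i (~: A).
Proof. by apply/finset.setP => k; rewrite !(inE, in_flip) addbN. Qed.

Lemma card_flip i A : odd #|flip i A| = ~~ odd #|A|.
Proof.
rewrite /flip; case: ifPn => iA; last by rewrite cardsU1 iA.
by rewrite [in RHS](cardsD1 i A) iA /= negbK.
Qed.

Lemma belowE i A : below i A = (\sum_(j < n | (j < i)%N) (j \in A))%N.
Proof.
rewrite /below -sum1dep_card big_mkcond [RHS]big_mkcond /=; apply: eq_bigr => j _.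
by case: (j \in A); case: (j < i)%N.
Qed.

Lemma below_flip i j A : odd (below i (flip j A)) = (j < i)%N (+) odd (below i A).
Proof.
rewrite !belowE; have [ji|ji] := boolP (j < i)%N; last first.
  congr (odd _); apply: eq_bigr => k ki; rewrite in_flip.
  by case: eqP => // kj; rewrite kj (negbTE ji) in ki.
have splitj B : (\sum_(k < n | (k < i)%N) (k \in B) =
    (j \in B) + \sum_(k < n | (k < i)%N && (k != j)) (k \in B))%N.
  by rewrite (bigD1 j).
rewrite !splitj !oddD in_flip eqxx /=.
rewrite (eq_bigr (fun k : 'I_n => nat_of_bool (k \in A))) => [|k /andP[_ kj]].
  by rewrite !oddb addNb.
by rewrite in_flip (negbTE kj).
Qed.

Definition sgn i A : R := (-1) ^+ below i A.

Lemma sgn_flip i j A : sgn i (flip j A) = (-1) ^+ (j < i)%N * sgn i A.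
Proof. by rewrite /sgn -signr_odd below_flip signr_addb signr_odd. Qed.

Lemma sgn_mul i A : sgn i A * sgn i A = 1.
Proof. by rewrite /sgn -expr2 sqrr_sign. Qed.

(** In the coefficient of dx_A after multiplication by v, an index i in A was created by the
    covector part, and an index i outside A was removed by the vector part. *)
Definition slot v i (occ : bool) : R := if occ then v.2 0 i else v.1 0 i.

Lemma inversions1 i A : inversions [set i] A = below i A.
Proof.
rewrite /inversions /below -(card_imset (mem [set j in A | (j < i)%N]) (f := fun j => (i, j))).
  apply: eq_card => -[p q]; rewrite !inE /=; apply/and3P/imsetP.
    by case=> /eqP -> qA qi; exists q; rewrite ?inE ?qA.
  by case=> j; rewrite !inE => /andP[jA ji] [-> ->].
by move=> j k [].
Qed.

Lemma below_setD1 i A : below i (A :\ i) = below i A.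
Proof.
rewrite !belowE; apply: eq_bigr => j ji; rewrite !inE.
by case: eqP ji => // ->; rewrite ltnn.
Qed.

(* The basis vectors of T and T^* act as the Jordan-Wigner operators. *)
Lemma coef_cliffE v a A :
  coef (cliff v a) A = \sum_i sgn i A * slot v i (i \in A) * coef a (flip i A).
Proof.
rewrite coefD !coef_mkform [RHS](bigID (fun i => i \notin A)) /=; congr (_ + _).
  apply: eq_bigr => i iA; rewrite inversions1 /slot /flip (negbTE iA).
  by rewrite /sgn.
rewrite [RHS](eq_bigl (fun i => i \in A)) => [|i]; last by rewrite negbK.
under eq_bigr => B _ do rewrite coef_mkform.
rewrite (eq_bigr (fun B => \sum_i (if B == [set i] then
  (-1) ^+ inversions B (A :\: B) * v.2 0 i * coef a (A :\: B) else 0))); last first.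
  move=> B _; rewrite mulr_sumr mulr_suml; apply: eq_bigr => i _.
  by case: eqP; rewrite ?mulr1 ?mulr0 ?mul0r.
rewrite exchange_big /= [RHS]big_mkcond; apply: eq_bigr => i _.
rewrite -big_mkcondr /=; case: ifPn => iA.
  rewrite (big_pred1 [set i]) => [|B]; last first.
    by rewrite /=; case: eqP => [->|]; rewrite ?andbF // finset.sub1set iA.
  by rewrite inversions1 below_setD1 /slot /flip iA.
rewrite big_pred0 // => B; case: eqP => [->|]; rewrite ?andbF //.
by rewrite finset.sub1set (negbTE iA).
Qed.

Lemma slotD u v i e : slot (u + v) i e = slot u i e + slot v i e.
Proof. by case: e; rewrite /slot /= mxE. Qed.

Lemma slotZ k v i e : slot (k *: v) i e = k * slot v i e.
Proof. by case: e; rewrite /slot /= mxE. Qed.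

Lemma cliffDl u v a : cliff (u + v) a = cliff u a + cliff v a.
Proof.
apply: coef_inj => A; rewrite coefD !coef_cliffE -big_split /=.
by apply: eq_bigr => i _; rewrite slotD; ring.
Qed.

Lemma cliffZl k v a : cliff (k *: v) a = k *: cliff v a.
Proof.
apply: coef_inj => A; rewrite coef_formZ !coef_cliffE mulr_sumr.
by apply: eq_bigr => i _; rewrite slotZ; ring.
Qed.

Lemma cliffDr v a b : cliff v (a + b) = cliff v a + cliff v b.
Proof.
apply: coef_inj => A; rewrite coefD !coef_cliffE -big_split /=.
by apply: eq_bigr => i _; rewrite coefD; ring.
Qed.

Lemma cliffZr k v a : cliff v (k *: a) = k *: cliff v a.
Proof.
apply: coef_inj => A; rewrite coef_formZ !coef_cliffE mulr_sumr.
by apply: eq_bigr => i _; rewrite coef_formZ; ring.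
Qed.

Lemma cliffNl v a : cliff (- v) a = - cliff v a.
Proof. by rewrite -scaleN1r cliffZl scaleN1r. Qed.

Lemma cliffNr v a : cliff v (- a) = - cliff v a.
Proof. by rewrite -scaleN1r cliffZr scaleN1r. Qed.

Lemma cliff0l a : cliff 0 a = 0.
Proof. by rewrite -(scale0r 0) cliffZl scale0r. Qed.

Lemma cliff0r v : cliff v 0 = 0.
Proof. by rewrite -(scale0r 0) cliffZr !scale0r. Qed.

Lemma cliff_suml (I : Type) (r : seq I) (P : pred I) (F : I -> gvec R n) a :
  cliff (\sum_(i <- r | P i) F i) a = \sum_(i <- r | P i) cliff (F i) a.
Proof.
apply: (big_morph (fun v => cliff v a)) => [u v|]; first exact: cliffDl.
exact: cliff0l.
Qed.

Lemma cliff_sumr (I : Type) (r : seq I) (P : pred I) v (F : I -> form R n) :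
  cliff v (\sum_(i <- r | P i) F i) = \sum_(i <- r | P i) cliff v (F i).
Proof.
apply: (big_morph (cliff v)) => [a b|]; first exact: cliffDr.
exact: cliff0r.
Qed.

Lemma cliff_covec (X : 'rV[R]_n) a : cliff (0, X) a = wedge (covec X) a.
Proof.
rewrite /cliff /= [contract _ _](_ : _ = 0) ?add0r //.
apply: coef_inj => A; rewrite coef_mkform coef_form0 big1 // => i _.
by rewrite mxE mulr0 mul0r.
Qed.

Lemma ipC u v : ip u v = ip v u.
Proof. by rewrite /ip addrC. Qed.

Lemma ipE u v :
  ip u v = 2%:R^-1 * \sum_i (u.1 0 i * v.2 0 i + v.1 0 i * u.2 0 i).
Proof. by rewrite /ip /pairing big_split. Qed.

Lemma ipDl u v w : ip (u + v) w = ip u w + ip v w.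
Proof.
rewrite !ipE -mulrDr -big_split /=; congr (_ * _).
by apply: eq_bigr => i _; rewrite !mxE; ring.
Qed.

Lemma ipZl k u w : ip (k *: u) w = k * ip u w.
Proof.
rewrite !ipE mulrCA; congr (_ * _); rewrite mulr_sumr.
by apply: eq_bigr => i _; rewrite !mxE; ring.
Qed.

Lemma ipDr u v w : ip w (u + v) = ip w u + ip w v.
Proof. by rewrite ipC ipDl !(ipC w). Qed.

Lemma ipZr k u w : ip w (k *: u) = k * ip w u.
Proof. by rewrite ipC ipZl (ipC w). Qed.

Lemma ipNl u w : ip (- u) w = - ip u w.
Proof. by rewrite -scaleN1r ipZl mulN1r. Qed.

Lemma ipNr u w : ip w (- u) = - ip w u.
Proof. by rewrite ipC ipNl ipC. Qed.

Lemma ip0l u : ip 0 u = 0.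
Proof. by rewrite -(scale0r 0) ipZl mul0r. Qed.

Lemma ip_basis1 u i : ip u (basis_vec i, 0) = 2%:R^-1 * u.2 0 i.
Proof.
rewrite ipE; congr (_ * _); rewrite (bigD1 i) //= big1 => [|j ji].
  by rewrite !mxE !eqxx /=; ring.
by rewrite !mxE (negbTE ji) andbF /=; ring.
Qed.

Lemma ip_basis2 u i : ip u (0, basis_vec i) = 2%:R^-1 * u.1 0 i.
Proof.
rewrite ipE; congr (_ * _); rewrite (bigD1 i) //= big1 => [|j ji].
  by rewrite !mxE !eqxx /=; ring.
by rewrite !mxE (negbTE ji) andbF /=; ring.
Qed.

Lemma ip_nondegenerate u : (forall v, ip u v = 0) -> u = 0.
Proof.
have two0 : (2%:R^-1 : R) != 0 by rewrite invr_eq0 pnatr_eq0.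
move=> u0; case: u u0 => X xi u0; congr pair; apply/rowP => i; rewrite !mxE.
  by have /eqP := u0 (0, basis_vec i); rewrite ip_basis2 mulf_eq0 (negbTE two0) /= => /eqP.
by have /eqP := u0 (basis_vec i, 0); rewrite ip_basis1 mulf_eq0 (negbTE two0) /= => /eqP.
Qed.

(** For i <> j exactly one of the two orders of toggling picks up a sign, so the off-diagonal terms
    cancel in pairs. The diagonal ones pair the vector part of one factor with the covector part of
    the other. *)
Lemma clifford u v a :
  cliff u (cliff v a) + cliff v (cliff u a) = (2%:R * ip u v) *: a.
Proof.
have expand x y A : coef (cliff x (cliff y a)) A = \sum_i \sum_j
    sgn i A * sgn j A * (-1) ^+ (i < j)%N * slot x i (i \in A) *
    slot y j ((j == i) (+) (j \in A)) * coef a (flip j (flip i A)).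
  rewrite coef_cliffE; apply: eq_bigr => i _; rewrite coef_cliffE mulr_sumr.
  by apply: eq_bigr => j _; rewrite sgn_flip in_flip; ring.
apply: coef_inj => A; rewrite coefD coef_formZ !expand [X in _ + X]exchange_big /=.
rewrite -big_split /= ipE mulrA divff ?pnatr_eq0 // mul1r mulr_suml.
apply: eq_bigr => i _; rewrite -big_split /= (bigD1 i) //= big1 ?addr0.
  rewrite !flipK !sgn_mul ltnn eqxx /slot /=.
  by case: (i \in A) => /=; ring.
move=> j ji; rewrite (flipC i j) (negbTE ji) eq_sym (negbTE ji) /=.
have : (j < i)%N = ~~ (i < j)%N by move: (ji : val j != val i); case: ltngtP.
by move=> ->; case: (i < j)%N => /=; ring.
Qed.

Lemma cliffC u v a :
  cliff u (cliff v a) = (2%:R * ip u v) *: a - cliff v (cliff u a).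
Proof. by rewrite -clifford addrK. Qed.

Lemma cliff_sqr v a : cliff v (cliff v a) = ip v v *: a.
Proof.
have /eqP := clifford v v a; rewrite -mulr2n -scaler_nat -scalerA -subr_eq0 -scalerBr scaler_eq0.
by rewrite pnatr_eq0 /= subr_eq0 => /eqP.
Qed.

Lemma is_evenD a b : is_even a -> is_even b -> is_even (a + b).
Proof. by move=> ea eb A oA; rewrite coefD ea ?eb ?addr0. Qed.

Lemma is_evenZ k a : is_even a -> is_even (k *: a).
Proof. by move=> ea A oA; rewrite coef_formZ ea ?mulr0. Qed.

Lemma is_oddD a b : is_odd a -> is_odd b -> is_odd (a + b).
Proof. by move=> ea eb A oA; rewrite coefD ea ?eb ?addr0. Qed.

Lemma is_oddZ k a : is_odd a -> is_odd (k *: a).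
Proof. by move=> ea A oA; rewrite coef_formZ ea ?mulr0. Qed.

Lemma cliff_even v a : is_even a -> is_odd (cliff v a).
Proof.
move=> ea A oA; rewrite coef_cliffE big1 // => i _.
by rewrite ea ?mulr0 // card_flip.
Qed.

(** The total sign of the Mukai pairing on complementary monomials: the reordering of dx_A and its
    complement, times [sigma] on the second factor. *)
Definition msgn A : R := (-1) ^+ (inversions A (~: A) + #|~: A|./2).

Lemma mukaiE a b : mukai a b = \sum_A msgn A * coef a A * coef b (~: A).
Proof.
rewrite /mukai /top coef_mkform; apply: eq_big => [A|A _]; first exact: finset.subsetT.
by rewrite finset.setTD coef_mkform /msgn exprD; ring.
Qed.

Lemma mukaiDl a b c : mukai (a + b) c = mukai a c + mukai b c.
Proof. by rewrite !mukaiE -big_split /=; apply: eq_bigr => A _; rewrite coefD; ring. Qed.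

Lemma mukaiZl k a c : mukai (k *: a) c = k * mukai a c.
Proof. by rewrite !mukaiE mulr_sumr /=; apply: eq_bigr => A _; rewrite coef_formZ; ring. Qed.

Lemma mukaiDr a b c : mukai a (b + c) = mukai a b + mukai a c.
Proof. by rewrite !mukaiE -big_split /=; apply: eq_bigr => A _; rewrite coefD; ring. Qed.

Lemma mukaiZr k a c : mukai a (k *: c) = k * mukai a c.
Proof. by rewrite !mukaiE mulr_sumr /=; apply: eq_bigr => A _; rewrite coef_formZ; ring. Qed.

Lemma mukaiNl a b : mukai (- a) b = - mukai a b.
Proof. by rewrite -scaleN1r mukaiZl mulN1r. Qed.

Lemma mukai0r a : mukai a 0 = 0.
Proof. by rewrite -(scale0r 0) mukaiZr mul0r. Qed.

Definition dx A : form R n := mkform (fun B => (B == A)%:R).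

Lemma mukai_dx a A : mukai a (dx A) = msgn (~: A) * coef a (~: A).
Proof.
rewrite mukaiE (bigD1 (~: A)) //= big1 ?addr0 => [|B BA].
  by rewrite coef_mkform finset.setCK eqxx mulr1.
rewrite coef_mkform (_ : (~: B == A) = false) ?mulr0 //.
by apply: contraNF BA => /eqP <-; rewrite finset.setCK.
Qed.

Lemma msgn_neq0 A : msgn A != 0.
Proof. by rewrite /msgn signr_eq0. Qed.

Lemma dx_sum a : a = \sum_A coef a A *: dx A.
Proof.
apply: coef_inj => A; rewrite coef_form_sum (bigD1 A) //= big1 => [|B BA].
  by rewrite coef_formZ coef_mkform eqxx mulr1 addr0.
by rewrite coef_formZ coef_mkform eq_sym (negbTE BA) mulr0.
Qed.

End CliffordAlgebra.

(** * Dimension five *)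

Section MukaiSigns.
Context {R : realType} {n : nat}.
Implicit Types (a b : form R n) (v : gvec R n) (A B : {set 'I_n}) (i j : 'I_n).

Lemma below_setC i A : (below i A + below i (~: A))%N = i.
Proof.
rewrite !belowE -big_split /= (eq_bigr (fun=> 1%N)) => [|j _].
  by rewrite -(big_ord_widen n (fun=> 1%N) (ltnW (ltn_ord i))) sum1_card card_ord.
by rewrite !inE; case: (j \in A).
Qed.

Lemma inversionsE A B : inversions A B = (\sum_(p in A) below p B)%N.
Proof.
rewrite /inversions -sum1dep_card.
rewrite [RHS](eq_bigr (fun p : 'I_n => \sum_(q < n | (q \in B) && (q < p)%N) 1)%N); last first.
  by move=> p _; rewrite /below -sum1dep_card.
rewrite pair_big_dep /=; apply: eq_bigl => -[p q] /=.
by rewrite andbA.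
Qed.

(** Counting pairs: the doubled sum compares each p in A once with each of the other #|A| - 1
    elements. *)
Lemma sum_below A : (\sum_(p in A) below p A)%N = 'C(#|A|, 2).
Proof.
have belowA p : below p A = (\sum_(q in A) (q < p)%N)%N.
  rewrite /below -sum1dep_card big_mkcondr /=.
  by apply: eq_bigr => q _; case: (q < p)%N.
apply/eqP; rewrite -(eqn_pmul2l (m := 2)) // mul2n -addnn.
under eq_bigr => p _ do rewrite belowA.
rewrite [X in (_ + X)%N]exchange_big /= -big_split /=.
rewrite (eq_bigr (fun=> #|A|.-1)) => [|p pA].
  rewrite sum_nat_const bin2 mul2n -{1}(odd_double_half (#|A| * #|A|.-1)).
  by case: #|A| => [|k] //=; rewrite oddM /= andNb.
rewrite -big_split /= (cardsD1 p A) pA /= -sum1_card.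
rewrite (bigD1 p) //= ltnn add0n; apply: eq_big => [q|q /andP[qA qp]].
  by rewrite !inE andbC.
by move: (qp : val q != val p); case: ltngtP.
Qed.

(** The p indices smaller than p are shared between A and its complement. *)
Lemma inversions_setC A :
  (inversions A (~: A) + 'C(#|A|, 2) = \sum_(p in A) p)%N.
Proof.
rewrite -sum_below inversionsE -big_split /=; apply: eq_bigr => p _.
by rewrite addnC below_setC.
Qed.

Lemma coef_cliff_basis1 i a A :
  coef (cliff (basis_vec i, 0) a) A = if i \in A then 0 else sgn i A * coef a (flip i A).
Proof.
rewrite coef_cliffE (bigD1 i) //= big1 ?addr0 => [|j ji].
  by rewrite /slot !mxE !eqxx; case: ifP => _ /=; ring.
by rewrite /slot !mxE (negbTE ji) andbF; case: ifP => _ /=; ring.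
Qed.

Lemma coef_cliff_basis2 i a A :
  coef (cliff (0, basis_vec i) a) A = if i \in A then sgn i A * coef a (flip i A) else 0.
Proof.
rewrite coef_cliffE (bigD1 i) //= big1 ?addr0 => [|j ji].
  by rewrite /slot !mxE !eqxx; case: ifP => _ /=; ring.
by rewrite /slot !mxE (negbTE ji) andbF; case: ifP => _ /=; ring.
Qed.

End MukaiSigns.

Section DimensionFive.
Context {R : realType}.
Implicit Types (a b c : form R 5) (u v w : gvec R 5) (A B : {set 'I_5}) (i j : 'I_5).

(* In dimension 5 the sign of sigma cancels the binomial coefficient of
   [inversions_setC]. *)
Lemma msgnE A : msgn A = (-1) ^+ (\sum_(p in A) p)%N :> R.
Proof.
rewrite /msgn -inversions_setC !exprD; congr (_ * _).
have -> : #|~: A| = (5 - #|A|)%N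
  by have := cardsC A; rewrite card_ord; move: #|A| #|~: A| => x y; lia.
have := max_card (mem A); rewrite card_ord.
rewrite -signr_odd -[RHS]signr_odd.
by case: #|A| => [|[|[|[|[|[|]]]]]].
Qed.

Lemma sum_flip i A :
  odd (\sum_(p in flip i A) p) = odd i (+) odd (\sum_(p in A) p).
Proof.
rewrite ![(\sum_(p in _) _)%N]big_mkcond /= !(bigD1 (P := predT) i) //= !oddD.
rewrite in_flip eqxx /= (eq_bigr (fun p : 'I_5 => if p \in A then nat_of_ord p else 0%N)).
  by case: (i \in A); rewrite /= ?addbA ?addbb ?addFb.
by move=> p pi; rewrite in_flip (negbTE pi).
Qed.

Lemma msgn_flip i A : msgn (flip i A) = (-1) ^+ i * msgn A :> R.
Proof. by rewrite !msgnE -signr_odd sum_flip signr_addb !signr_odd. Qed.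

(** 0 + 1 + 2 + 3 + 4 = 10 is even, so the index sums of A and of its complement have the same
    parity. This is why the pairing is symmetric in dimension 5. *)
Lemma msgn_setC A : msgn (~: A) = msgn A :> R.
Proof.
rewrite !msgnE; apply: (mulIf (x := (-1) ^+ (\sum_(p in A) p)%N)).
  by rewrite signr_eq0.
rewrite -exprD -expr2 sqrr_sign addnC.
rewrite (_ : (_ + _)%N = (\sum_(p < 5) p)%N); last first.
  rewrite [RHS](bigID (fun p => p \in A)) /=; congr (_ + _)%N.
  by apply: eq_bigl => p; rewrite inE.
by rewrite !big_ord_recl big_ord0 /= -signr_odd.
Qed.

Lemma mukaiC a b : mukai a b = mukai b a.
Proof.
rewrite !mukaiE (reindex_inj (@finset.setC_inj _)) /=; apply: eq_bigr => A _.
by rewrite msgn_setC finset.setCK; ring.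
Qed.

(** After reindexing by [flip i], [msgn] contributes (-1)^i, which equals the product of the two
    signs of i relative to A and to its complement; everything cancels. *)
Lemma mukai_cliff v a b : mukai (cliff v a) b = mukai a (cliff v b).
Proof.
transitivity (\sum_A \sum_i msgn A * sgn i A * slot v i (i \in A) *
    coef a (flip i A) * coef b (~: A)).
  rewrite mukaiE; apply: eq_bigr => A _; rewrite coef_cliffE mulr_sumr mulr_suml.
  by apply: eq_bigr => i _; ring.
transitivity (\sum_A \sum_i msgn A * sgn i (~: A) * slot v i (i \notin A) *
    coef a A * coef b (flip i (~: A))); last first.
  rewrite mukaiE; apply: eq_bigr => A _; rewrite coef_cliffE mulr_sumr.
  by apply: eq_bigr => i _; rewrite inE; ring.
rewrite exchange_big [RHS]exchange_big /=; apply: eq_bigr => i _.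
rewrite [RHS](reindex_inj (inv_inj (@flipK _ i))) /=; apply: eq_bigr => A _.
rewrite flip_setC flipK in_flip eqxx negbK msgn_flip sgn_flip ltnn mul1r.
have <- : sgn i A * sgn i (~: A) = (-1) ^+ i :> R by rewrite -exprD below_setC.
transitivity (msgn A * (sgn i (~: A) * sgn i (~: A)) * sgn i A * slot v i (i \in A) *
    coef a (flip i A) * coef b (~: A)); last by ring.
by rewrite sgn_mul; ring.
Qed.

Lemma mukai_swap v a b : mukai (cliff v a) b = mukai (cliff v b) a.
Proof. by rewrite mukai_cliff mukaiC. Qed.

(** As 5 is odd, the complement of an odd index set is even, so its monomial is an allowed test form
    and reads off one coefficient of a up to sign. *)
Lemma mukai_nondegenerate a :
  is_odd a -> (forall b, is_even b -> mukai a b = 0) -> a = 0.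
Proof.
move=> oa a0; apply: coef_inj => A; rewrite coef_form0.
have [oA|eA] := boolP (odd #|A|); last exact: oa.
have oAC : ~~ odd #|~: A|.
  by have := cardsC A; rewrite card_ord => /(congr1 odd); rewrite oddD oA /=; case: (odd _).
have /a0 : is_even (dx (~: A) : form R 5).
  move=> B oB; rewrite coef_mkform; case: eqP => // BA.
  by rewrite -BA oB in oAC.
by rewrite mukai_dx finset.setCK => /eqP; rewrite mulf_eq0 (negbTE (msgn_neq0 _)) => /eqP.
Qed.

Lemma mukai_cliff_polar v a b : mukai (cliff v (a + b)) (a + b) =
  mukai (cliff v a) a + 2%:R * mukai (cliff v a) b + mukai (cliff v b) b.
Proof.
rewrite cliffDr mukaiDr !(mukaiDl (cliff v a)) (mukai_swap v b a); ring.
Qed.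

Lemma mukai_cliffZ v k a b : mukai (cliff v (k *: a)) b = k * mukai (cliff v a) b.
Proof. by rewrite cliffZr mukaiZl. Qed.

(** The polarization of Q; on rho_1 and rho_2 it is the coefficient phi h of 2 z. *)
Definition QB a b : gvec R 5 :=
  (\row_i (2%:R * mukai (cliff (0, basis_vec i) a) b),
   \row_i (2%:R * mukai (cliff (basis_vec i, 0) a) b)).

Lemma QD a b : Q (a + b) = Q a + 2%:R *: QB a b + Q b.
Proof. by congr pair; apply/rowP => i; rewrite !mxE mukai_cliff_polar; ring. Qed.

Lemma QBE a b v : ip (QB a b) v = mukai (cliff v a) b.
Proof.
have two0 : (2%:R : R) != 0 by rewrite pnatr_eq0.
apply: (mulfI two0); have := QE (a + b) v.
rewrite QD !ipDl ipZl !QE mukai_cliff_polar; lra.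
Qed.

Lemma QBC a b : QB a b = QB b a.
Proof. by congr pair; apply/rowP => i; rewrite !mxE mukai_swap. Qed.

Lemma QZ k a : Q (k *: a) = k ^+ 2 *: Q a.
Proof. by congr pair; apply/rowP => i; rewrite !mxE mukai_cliffZ mukaiZr; ring. Qed.

Lemma QBZr k a b : QB a (k *: b) = k *: QB a b.
Proof. by congr pair; apply/rowP => i; rewrite !mxE !mukaiZr; ring. Qed.

Lemma QBZl k a b : QB (k *: a) b = k *: QB a b.
Proof. by rewrite QBC QBZr QBC. Qed.

Lemma QB_diag a : QB a a = Q a.
Proof. by []. Qed.

(** Subsets as bit patterns: sums over the 32 subsets become explicit, and complements, togglings
    and signs compute on booleans. *)
Definition mk (b0 b1 b2 b3 b4 : bool) : {set 'I_5} :=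
  [set i : 'I_5 | nth false [:: b0; b1; b2; b3; b4] i].

Lemma sum_mk (F : {set 'I_5} -> R) : \sum_A F A =
  \sum_(b0 : bool) \sum_(b1 : bool) \sum_(b2 : bool) \sum_(b3 : bool)
    \sum_(b4 : bool) F (mk b0 b1 b2 b3 b4).
Proof.
rewrite !pair_bigA /= (reindex (fun p : bool * bool * bool * bool * bool =>
  mk p.1.1.1.1 p.1.1.1.2 p.1.1.2 p.1.2 p.2)) //=.
pose o (k : nat) (A : {set 'I_5}) : bool := inord k \in A.
apply: onW_bij; exists (fun A => (o 0%N A, o 1%N A, o 2 A, o 3 A, o 4 A)).
  by move=> [[[[b0 b1] b2] b3] b4]; rewrite /o !inE !inordK.
move=> A; apply/finset.setP => i; rewrite inE /o.
by case: i => -[|[|[|[|[|//]]]]] lti /=; congr (_ \in A); apply/val_inj; rewrite /= inordK.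
Qed.

Lemma mkC (b0 b1 b2 b3 b4 : bool) :
  ~: mk b0 b1 b2 b3 b4 = mk (~~ b0) (~~ b1) (~~ b2) (~~ b3) (~~ b4).
Proof. by apply/finset.setP => -[[|[|[|[|[|//]]]]] lti]; rewrite !inE. Qed.

Lemma card_mk (b0 b1 b2 b3 b4 : bool) : #|mk b0 b1 b2 b3 b4| = (b0 + b1 + b2 + b3 + b4)%N.
Proof.
rewrite -sum1_card big_mkcond !big_ord_recl big_ord0 /= !inE /= addn0 !addnA.
by case: b0; case: b1; case: b2; case: b3; case: b4.
Qed.

Lemma msgn_mk (b0 b1 b2 b3 b4 : bool) : msgn (mk b0 b1 b2 b3 b4) = (-1) ^+ (b1 (+) b3) :> R.
Proof.
rewrite msgnE big_mkcond !big_ord_recl big_ord0 /= !inE /= -signr_odd.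
by case: b0; case: b1; case: b2; case: b3; case: b4.
Qed.

Definition o0 : 'I_5 := @Ordinal 5 0 isT.
Definition o1 : 'I_5 := @Ordinal 5 1 isT.
Definition o2 : 'I_5 := @Ordinal 5 2 isT.
Definition o3 : 'I_5 := @Ordinal 5 3 isT.
Definition o4 : 'I_5 := @Ordinal 5 4 isT.

Lemma sum_o (V : zmodType) (F : 'I_5 -> V) :
  \sum_i F i = F o0 + F o1 + F o2 + F o3 + F o4.
Proof.
rewrite !big_ord_recl big_ord0 addr0 !addrA.
by do ![congr (_ + _)]; congr F; apply/val_inj.
Qed.

Lemma in_mk (b0 b1 b2 b3 b4 : bool) : (((o0 \in mk b0 b1 b2 b3 b4) = b0) *
  ((o1 \in mk b0 b1 b2 b3 b4) = b1) * ((o2 \in mk b0 b1 b2 b3 b4) = b2) *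
  ((o3 \in mk b0 b1 b2 b3 b4) = b3) * ((o4 \in mk b0 b1 b2 b3 b4) = b4))%type.
Proof. by rewrite !inE. Qed.

Lemma flip_mk (b0 b1 b2 b3 b4 : bool) : (((flip o0 (mk b0 b1 b2 b3 b4)) = mk (~~ b0) b1 b2 b3 b4) *
  ((flip o1 (mk b0 b1 b2 b3 b4)) = mk b0 (~~ b1) b2 b3 b4) *
  ((flip o2 (mk b0 b1 b2 b3 b4)) = mk b0 b1 (~~ b2) b3 b4) *
  ((flip o3 (mk b0 b1 b2 b3 b4)) = mk b0 b1 b2 (~~ b3) b4) *
  ((flip o4 (mk b0 b1 b2 b3 b4)) = mk b0 b1 b2 b3 (~~ b4)))%type.
Proof.
do !split; apply/finset.setP => -[[|[|[|[|[|//]]]]] lti]; by rewrite in_flip !inE.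
Qed.

Lemma sgn_mk (b0 b1 b2 b3 b4 : bool) : ((sgn o0 (mk b0 b1 b2 b3 b4) = 1 :> R) *
  (sgn o1 (mk b0 b1 b2 b3 b4) = (-1) ^+ b0 :> R) *
  (sgn o2 (mk b0 b1 b2 b3 b4) = (-1) ^+ (b0 (+) b1) :> R) *
  (sgn o3 (mk b0 b1 b2 b3 b4) = (-1) ^+ (b0 (+) b1 (+) b2) :> R) *
  (sgn o4 (mk b0 b1 b2 b3 b4) = (-1) ^+ (b0 (+) b1 (+) b2 (+) b3) :> R))%type.
Proof.
do !split; rewrite /sgn belowE big_mkcond !big_ord_recl big_ord0 /= ?inE /=.
- by rewrite expr0.
- by case: b0.
- by rewrite -signr_odd; case: b0; case: b1.
- by rewrite -signr_odd; case: b0; case: b1; case: b2.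
- by rewrite -signr_odd; case: b0; case: b1; case: b2; case: b3.
Qed.

End DimensionFive.

(** * The ten quadrics of an even form and their nullity *)

Section QuarticIdentity.
Context {R : realType}.
Implicit Types (a b c : form R 5) (u v w : gvec R 5) (A B : {set 'I_5}) (i j : 'I_5).

Lemma Q1E i a : (Q a).1 0 i = 2%:R * \sum_(A : {set _}) (if i \in A then
  msgn A * (sgn i A * coef a (flip i A)) * coef a (~: A) else 0).
Proof.
rewrite mxE mukaiE; congr (_ * _); apply: eq_bigr => A _.
by rewrite coef_cliff_basis2; case: ifP; rewrite ?mulr0 ?mul0r.
Qed.

Lemma Q2E i a : (Q a).2 0 i = 2%:R * \sum_(A : {set _}) (if i \in A then 0 else
  msgn A * (sgn i A * coef a (flip i A)) * coef a (~: A)).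
Proof.
rewrite mxE mukaiE; congr (_ * _); apply: eq_bigr => A _.
by rewrite coef_cliff_basis1; case: ifP; rewrite ?mulr0 ?mul0r.
Qed.

(* The parity of an even index determines its last bit. *)
Lemma coef_mk_even a : is_even a -> exists e : bool -> bool -> bool -> bool -> R,
  forall b0 b1 b2 b3 b4 : bool, coef a (mk b0 b1 b2 b3 b4) =
    if b0 (+) b1 (+) b2 (+) b3 (+) b4 then 0 else e b0 b1 b2 b3.
Proof.
move=> ea; exists (fun b0 b1 b2 b3 : bool => coef a (mk b0 b1 b2 b3 (b0 (+) b1 (+) b2 (+) b3))).
move=> b0 b1 b2 b3 b4; case: ifP => [oA|].
  by apply: ea; rewrite card_mk !oddD !oddb.
by rewrite addbC => /negbT; rewrite negb_add => /eqP ->.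
Qed.

Local Notation F := false (only parsing).
Local Notation T := true (only parsing).

Ltac gen16 e :=
  move: (e F F F F) (e F F F T) (e F F T F) (e F F T T) (e F T F F)
    (e F T F T) (e F T T F) (e F T T T) (e T F F F) (e T F F T)
    (e T F T F) (e T F T T) (e T T F F) (e T T F T) (e T T T F) (e T T T T) =>
  x0 x1 x2 x3 x4 x5 x6 x7 x8 x9 x10 x11 x12 x13 x14 x15.

(** For a = a_0 + a_2 + a_4, the vector part lists, up to signs, the coefficients of a_0 a_4 - a_2
    /\ a_2 / 2, and the covector part is the contraction of a_2 with the vector dual to a_4. The
    factor 4 is the 2 in [Q] times 2, since each product arises from two index sets. *)
Lemma Q_coords a (e : bool -> bool -> bool -> bool -> R) :
  (forall b0 b1 b2 b3 b4 : bool, coef a (mk b0 b1 b2 b3 b4) =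
    if b0 (+) b1 (+) b2 (+) b3 (+) b4 then 0 else e b0 b1 b2 b3) ->
  [/\ (Q a).1 0 o0 = 4%:R * (e F F F F * e F T T T - e F F F T * e F T T F
        + e F F T F * e F T F T - e F F T T * e F T F F),
      (Q a).1 0 o1 = 4%:R * (- e F F F F * e T F T T + e F F F T * e T F T F
        - e F F T F * e T F F T + e F F T T * e T F F F),
      (Q a).1 0 o2 = 4%:R * (e F F F F * e T T F T - e F F F T * e T T F F
        + e F T F F * e T F F T - e F T F T * e T F F F),
      (Q a).1 0 o3 = 4%:R * (- e F F F F * e T T T F + e F F T F * e T T F F
        - e F T F F * e T F T F + e F T T F * e T F F F) &
      (Q a).1 0 o4 = 4%:R * (e F F F F * e T T T T - e F F T T * e T T F F
        + e F T F T * e T F T F - e F T T F * e T F F T)] /\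
  [/\ (Q a).2 0 o0 = 4%:R * (e T F F F * e T T T T - e T F F T * e T T T F
        + e T F T F * e T T F T - e T F T T * e T T F F),
      (Q a).2 0 o1 = 4%:R * (e F T F F * e T T T T - e F T F T * e T T T F
        + e F T T F * e T T F T - e F T T T * e T T F F),
      (Q a).2 0 o2 = 4%:R * (e F F T F * e T T T T - e F F T T * e T T T F
        + e F T T F * e T F T T - e F T T T * e T F T F),
      (Q a).2 0 o3 = 4%:R * (e F F F T * e T T T T - e F F T T * e T T F T
        + e F T F T * e T F T T - e F T T T * e T F F T) &
      (Q a).2 0 o4 = 4%:R * (e F F F T * e T T T F - e F F T F * e T T F T
        + e F T F F * e T F T T - e F T T T * e T F F F)].
Proof.
move=> eE; split; split; [rewrite Q1E | rewrite Q1E | rewrite Q1E | rewrite Q1E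
  | rewrite Q1E | rewrite Q2E | rewrite Q2E | rewrite Q2E | rewrite Q2E | rewrite Q2E];
  rewrite sum_mk !big_bool;
  rewrite !in_mk /= !flip_mk !sgn_mk /= !msgn_mk /= !mkC /= !eE /=;
  rewrite !(mulr0, mul0r, addr0, add0r, expr0, expr1, mul1r); gen16 e; ring.
Qed.

(** Invariantly: a_2 vanishes when contracted twice with the vector dual to a_4, and also when
    contracted with the vector dual to a_2 /\ a_2. *)
Lemma Q_null a : is_even a -> ip (Q a) (Q a) = 0.
Proof.
move=> /coef_mk_even [e /Q_coords [[? ? ? ? ?] [? ? ? ? ?]]].
rewrite ipE sum_o; do 10![match goal with H : _ = _ |- _ => rewrite H; clear H end].
gen16 e; ring.
Qed.

End QuarticIdentity.

(** * Stable pairs and the quartic invariant *)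

Section StablePairs.
Local Open Scope classical_set_scope.
Context {R : realType}.
Implicit Types (a b c : form R 5) (u v w : gvec R 5) (rho : form R 5 * form R 5).

Lemma Q_QB a b : is_even a -> is_even b ->
  [/\ ip (Q a) (QB a b) = 0, ip (QB a b) (Q b) = 0 &
      ip (QB a b) (QB a b) = - (2%:R^-1 * ip (Q a) (Q b))].
Proof.
move=> ea eb.
have p t : ip (Q (a + t *: b)) (Q (a + t *: b)) = 0.
  by apply: Q_null; apply: is_evenD => //; exact: is_evenZ.
(* This is a quartic polynomial in t that vanishes identically. Its extreme coefficients vanish by
   [Q_null], and the values at 1, -1 and 2 determine the three middle ones. *)
move: (p 1) (p (-1)) (p 2) (Q_null ea) (Q_null eb).
rewrite !QD !QZ !QBZr !(ipDl, ipDr, ipZl, ipZr) (ipC (Q b) (Q a))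
  (ipC (QB a b) (Q a)) (ipC (Q b) (QB a b)).
by split; lra.
Qed.

(* Up to a factor, (Q(a) . a, b) is the derivative of the zero function
   (Q a, Q a) in the direction b. *)
Lemma cliff_Q a : is_even a -> cliff (Q a) a = 0.
Proof.
move=> ea; apply: mukai_nondegenerate => [|b eb]; first exact: cliff_even.
by rewrite -QBE ipC; have [] := Q_QB ea eb.
Qed.

Lemma cliff_Q_QB a b : is_even a -> is_even b ->
  cliff (Q a) b = - (2%:R *: cliff (QB a b) a).
Proof.
move=> ea eb.
have p t : cliff (Q (a + t *: b)) (a + t *: b) = 0.
  by apply: cliff_Q; apply: is_evenD => //; exact: is_evenZ.
(* The terms of degree 0 and 3 in t vanish by [cliff_Q]; the difference of the values at 1 and -1
   isolates the term of degree 1. *)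
have := p (-1); have := p 1.
rewrite !QD !QZ !QBZr !(cliffDl, cliffDr, cliffZl, cliffZr) !cliff_Q //.
move: (cliff (Q a) b) (cliff (QB a b) a) (cliff (QB a b) b) (cliff (Q b) a) => x y z t.
move=> /rowP h1 /rowP h2; apply/rowP => i; move: (h1 i) (h2 i).
by rewrite !mxE; lra.
Qed.

Lemma Q0 : Q 0 = 0 :> gvec R 5.
Proof. by rewrite -[X in Q X](scale0r 0) QZ expr0n scale0r. Qed.

(* If (x, y) <> 0 then a is a multiple of x . (y . a), and x w x = 2 (x, w) x in
   the Clifford algebra since x is null. *)
Lemma Q_annihilated a x : x != 0 -> cliff x a = 0 -> exists k, Q a = k *: x.
Proof.
move=> x0 xa; have [->|a0] := eqVneq a 0.
  by exists 0; rewrite Q0 scale0r.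
have x_null : ip x x = 0.
  have := cliff_sqr x a; rewrite xa cliff0r => /esym/eqP.
  by rewrite scaler_eq0 (negbTE a0) orbF => /eqP.
have [y xy] : exists y, ip x y != 0.
  apply: contrapT => /forallNP h; move/eqP: x0; apply.
  by apply: ip_nondegenerate => y; have /negP := h y; rewrite negbK => /eqP.
have [b ->] : exists b, a = cliff x b.
  exists ((2%:R * ip x y)^-1 *: cliff y a); have := clifford x y a.
  rewrite xa cliff0r addr0 cliffZr => ->; rewrite scalerA mulVf ?scale1r //.
  by rewrite mulf_neq0 // pnatr_eq0.
exists (2%:R * mukai (cliff x b) b); apply/eqP; rewrite -subr_eq0; apply/eqP.
apply: ip_nondegenerate => w; rewrite ipDl ipNl ipZl QE -mukai_cliff cliffC.
rewrite (cliff_sqr x) x_null scale0r cliff0r subr0 mukaiZl (ipC x w).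
by ring.
Qed.

(** A nonzero x annihilating both forms would put Q a and Q b on the same line, spanned by x, which
    is null unless a = 0; either way f = 0. *)
Lemma cliff_pair_inj a b x : fquartic (a, b) != 0 ->
  cliff x a = 0 -> cliff x b = 0 -> x = 0.
Proof.
move=> f0 xa xb; apply/eqP; apply: contraNT f0 => x0.
have [k Qa] := Q_annihilated x0 xa; have [l Qb] := Q_annihilated x0 xb.
have [a0|a0] := eqVneq a 0.
  by rewrite /fquartic a0 /= Q0 ip0l.
have : ip x x = 0.
  have := cliff_sqr x a; rewrite xa cliff0r => /esym/eqP.
  by rewrite scaler_eq0 (negbTE a0) orbF => /eqP.
by rewrite /fquartic Qa Qb ipZl ipZr => ->; rewrite !mulr0.
Qed.

(** Multiplying a form by v with (v, v) = 1 or -1 changes its Q, up to sign, by the reflection along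
    v, which is an isometry. *)
Lemma ip_Q_cliff v a b : ip v v = 1 \/ ip v v = -1 ->
  ip (Q (cliff v a)) (Q (cliff v b)) = ip (Q a) (Q b).
Proof.
move=> vv.
have reflect c : Q (cliff v c) = (2%:R * ip (Q c) v) *: v - ip v v *: Q c.
  apply/eqP; rewrite -subr_eq0; apply/eqP; apply: ip_nondegenerate => w.
  rewrite ipDl ipNl QE -mukai_cliff cliffC (cliff_sqr v).
  rewrite cliffZr mukaiDl mukaiNl !mukaiZl -!QE !(ipDl, ipNl, ipZl) (ipC v w).
  by rewrite (ipC (Q c)); ring.
rewrite !reflect !(ipDl, ipDr, ipNl, ipNr, ipZl, ipZr) (ipC v (Q b)).
by case: vv => ->; ring.
Qed.

Lemma fquartic_spin s a b : spin_word s ->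
  fquartic (spin_act s a, spin_act s b) = fquartic (a, b).
Proof.
case=> _; elim: s => //= v s IHs unit_s.
rewrite /fquartic /= ip_Q_cliff; last by apply: unit_s; rewrite inE eqxx.
by apply: IHs => w ws; apply: unit_s; rewrite inE ws orbT.
Qed.

Lemma spin_actD s a b : spin_act s (a + b) = spin_act s a + spin_act s b.
Proof. by elim: s => //= v s ->; rewrite cliffDr. Qed.

Lemma spin_actZ s (k : R) a : spin_act s (k *: a) = k *: spin_act s a.
Proof. by elim: s => //= v s ->; rewrite cliffZr. Qed.

Lemma det22 (g : 'M[R]_2) : \det g = g 0 0 * g 1 1 - g 0 1 * g 1 0.
Proof.
rewrite (expand_det_row _ 0) !big_ord_recl big_ord0 /cofactor !det_mx11 !mxE /=.
rewrite expr0 expr1 mul1r mulN1r mulrN addr0.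
by do ![congr (_ - _) | congr (_ * _) | congr (g _ _) | apply/val_inj].
Qed.

(** For g with rows (x, y) and (z, w), the relations of [Q_QB] leave f times x^2 w^2 - 2 x y z w +
    y^2 z^2, the square of the determinant. *)
Lemma fquartic_gl2 (g : 'M[R]_2) rho : is_even2 rho ->
  fquartic (gl2_act g rho) = \det g ^+ 2 * fquartic rho.
Proof.
case: rho => a b [/= ea eb]; have [h1 h2 h3] := Q_QB ea eb.
rewrite /fquartic /gl2_act /= !QD !QZ !QBZr !QBZl det22.
rewrite !(ipDl, ipDr, ipZl, ipZr) (ipC (Q b) (Q a)) (ipC (Q b) (QB a b)) (ipC (QB a b) (Q a)).
by rewrite h1 h2 h3 !Q_null //; field.
Qed.

Lemma fquartic_orbit rho r : is_even2 rho -> orbit_of rho r ->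
  exists2 k : R, k != 0 & fquartic r = k * fquartic rho.
Proof.
case: rho => a b erho [s [g [ws gU ->]]].
have -> : gl2_act g (spin_act s (a, b).1, spin_act s (a, b).2) =
    (spin_act s (gl2_act g (a, b)).1, spin_act s (gl2_act g (a, b)).2).
  by rewrite /gl2_act /= !spin_actD !spin_actZ.
rewrite fquartic_spin // -surjective_pairing fquartic_gl2 //.
by exists (\det g ^+ 2) => //; rewrite expf_neq0 // -unitfE -unitmxE.
Qed.

Lemma is_even_dx (A : {set 'I_5}) : ~~ odd #|A| -> is_even (dx A : form R 5).
Proof.
move=> eA B oB; rewrite coef_mkform; case: eqP => // BA.
by rewrite BA (negbTE eA) in oB.
Qed.

Lemma eq_mk (b0 b1 b2 b3 b4 c0 c1 c2 c3 c4 : bool) :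
  (mk b0 b1 b2 b3 b4 == mk c0 c1 c2 c3 c4) =
  [&& b0 == c0, b1 == c1, b2 == c2, b3 == c3 & b4 == c4].
Proof.
apply/eqP/idP => [/finset.setP h|/and5P[/eqP-> /eqP-> /eqP-> /eqP-> /eqP->]] //.
by apply/and5P; split; apply/eqP;
  [have := h o0|have := h o1|have := h o2|have := h o3|have := h o4]; rewrite !in_mk.
Qed.

Lemma coef_dx_pair (A B C : {set 'I_5}) :
  coef (dx A + dx B : form R 5) C = (C == A)%:R + (C == B)%:R.
Proof. by rewrite coefD !coef_mkform. Qed.

Lemma fquartic_neq0_exists :
  exists2 rho : form R 5 * form R 5, is_even2 rho & fquartic rho != 0.
Proof.
(* The pair (1 + dx_0123, dx_04 + dx_1234), with indices from 0: Q of the first form is 4 e_4 and Q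
   of the second is - 4 dx_4, so f = - 8. *)
exists (dx (mk false false false false false) + dx (mk true true true true false),
        dx (mk true false false false true) + dx (mk false true true true true)).
  by split; apply: is_evenD; apply: is_even_dx; rewrite card_mk.
have a1 (b0 b1 b2 b3 b4 : bool) :
    coef (dx (mk false false false false false) + dx (mk true true true true false) : form R 5)
      (mk b0 b1 b2 b3 b4) = if b0 (+) b1 (+) b2 (+) b3 (+) b4 then 0 else
    ([&& ~~ b0, ~~ b1, ~~ b2 & ~~ b3] || [&& b0, b1, b2 & b3])%:R.
  rewrite coef_dx_pair !eq_mk.
  by case: b0; case: b1; case: b2; case: b3; case: b4; rewrite /= ?addr0 ?add0r.
have a2 (b0 b1 b2 b3 b4 : bool) :
    coef (dx (mk true false false false true) + dx (mk false true true true true) : form R 5)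
      (mk b0 b1 b2 b3 b4) = if b0 (+) b1 (+) b2 (+) b3 (+) b4 then 0 else
    ([&& b0, ~~ b1, ~~ b2 & ~~ b3] || [&& ~~ b0, b1, b2 & b3])%:R.
  rewrite coef_dx_pair !eq_mk.
  by case: b0; case: b1; case: b2; case: b3; case: b4; rewrite /= ?addr0 ?add0r.
have := Q_coords a2; have := Q_coords a1; rewrite /fquartic.
move: (Q _) (Q _) => /= q1 q2 [[h0 h1 h2 h3 h4] [k0 k1 k2 k3 k4]].
move=> [[h0' h1' h2' h3' h4'] [k0' k1' k2' k3' k4']].
rewrite ipE sum_o h0 h1 h2 h3 h4 k0 k1 k2 k3 k4.
rewrite h0' h1' h2' h3' h4' k0' k1' k2' k3' k4'.
by rewrite !(mulr0, mul0r, addr0, add0r, subr0, oppr0, mulr1)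
  !mulf_neq0 ?invr_eq0 ?pnatr_eq0 ?oppr_eq0 ?oner_eq0.
Qed.

End StablePairs.

(** * The quartic f along lines, and its nonvanishing on open orbits *)

Section OpenOrbit.
Local Open Scope classical_set_scope.
Context {R : realType}.
Implicit Types (a b c : form R 5) (u v w : gvec R 5) (rho s : form R 5 * form R 5).

(** Only two coefficients besides f(rho) are made explicit: the linear one gives the derivative of
    phi, and the leading one transfers the vanishing of f on a segment to its direction s. *)
Lemma fquartic_line rho s : exists c2 c3 : R, forall t : R,
  fquartic (rho + t *: s) = fquartic rho +
    2%:R * (mukai (cliff (Q rho.2) rho.1) s.1 + mukai (cliff (Q rho.1) rho.2) s.2) * t +
    c2 * t ^+ 2 + c3 * t ^+ 3 + fquartic s * t ^+ 4.
Proof.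
case: rho s => a b [a' b'] /=.
exists (ip (Q a) (Q b') + ip (Q a') (Q b) + 4%:R * ip (QB a a') (QB b b')).
exists (2%:R * (ip (QB a a') (Q b') + ip (Q a') (QB b b'))) => t.
rewrite /fquartic /= -!QBE !QD !QZ !QBZr !(ipDl, ipDr, ipZl, ipZr).
by rewrite (ipC (QB b b') (Q a)); ring.
Qed.

Lemma is_even2_line rho s (t : R) : is_even2 rho -> is_even2 s -> is_even2 (rho + t *: s).
Proof.
case: rho s => a b [a' b'] [/= ea eb] [/= ea' eb'].
by split; apply: is_evenD => //; exact: is_evenZ.
Qed.

Lemma line_cvg rho s : (rho + t *: s) @[t --> (0 : R)] --> rho.
Proof.
rewrite -[X in _ --> X]addr0 -(scale0r s); apply: cvgD; first exact: cvg_cst.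
exact: cvgZr_tmp.
Qed.

Lemma in_orbit rho : orbit_of rho rho.
Proof.
exists [::], 1%:M; split; [by split|exact: unitmx1|].
by case: rho => a b; rewrite /gl2_act /= !mxE /= !scale1r !scale0r addr0 add0r.
Qed.

(* Otherwise f vanishes on the orbit, hence on a segment through rho in each even
   direction s; but its coefficient of degree 4 there is f(s). *)
Lemma open_orbit_neq0 rho : is_even2 rho -> in_open_orbit rho -> fquartic rho != 0.
Proof.
move=> erho [U openU orbE]; apply/eqP => f0.
have [s even_s fs0] := @fquartic_neq0_exists R; move/eqP: fs0; apply.
have Urho : U rho by have := in_orbit rho; rewrite orbE => -[].
have f_orbit r : U r -> is_even2 r -> fquartic r = 0.
  move=> Ur er; have : orbit_of rho r by rewrite orbE.
  by move=> /(fquartic_orbit erho) [k _ ->]; rewrite f0 mulr0.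
have /nbhs_ballP [e /= e0 eU] : nbhs (0 : R) (fun t => U (rho + t *: s)).
  by apply: (@line_cvg rho s); apply: open_nbhs_nbhs; split.
have fz t : `|t| < e -> fquartic (rho + t *: s) = 0.
  by move=> te; apply: f_orbit; [apply: eU; rewrite /ball /= sub0r normrN|apply: is_even2_line].
have [c2 [c3 fE]] := fquartic_line rho s.
pose t := e / 3%:R; have t0 : 0 < t by rewrite divr_gt0.
have te : 2%:R * t < e by rewrite /t; lra.
have bound x : `|x| <= 2 -> `|x * t| < e.
  move=> x2; rewrite normrM (gtr0_norm t0); apply: le_lt_trans te.
  by rewrite ler_pM2r.
have := fz _ (bound 1 _); have := fz _ (bound (-1) _).
have := fz _ (bound 2 _); have := fz _ (bound (-2) _).
rewrite !normrN !normr1 !(ger0_norm (ler0n _ 2)) ler1n lexx !fE f0.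
move=> /(_ isT) h1 /(_ isT) h2 /(_ isT) h3 /(_ isT) h4.
(* The left-hand side is the fourth difference of the quartic polynomial at -2t, -t, 0, t, 2t; the
   choice t = e / 3 keeps these points in the ball where f vanishes. *)
have : 24%:R * t ^+ 4 * fquartic s = 0.
  have -> : 24%:R * t ^+ 4 * fquartic s =
    (0 + 0 + 0 + 0) + 24%:R * t ^+ 4 * fquartic s by ring.
  rewrite -{1}h1 -{1}h2; lra.
have t4 : 24%:R * t ^+ 4 != 0 by rewrite mulf_neq0 ?pnatr_eq0 ?expf_neq0 ?lt0r_neq0.
by move/eqP; rewrite mulf_eq0 (negbTE t4) => /eqP.
Qed.

End OpenOrbit.

(** * The derivative of phi and the forms rhat *)

Section HatForms.
Local Open Scope classical_set_scope.
Context {R : realType}.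
Implicit Types (a b c : form R 5) (u v w : gvec R 5) (rho s : form R 5 * form R 5).

Lemma near_sgr (T : Type) (F : set_system T) {FF : Filter F} (f : T -> R) (l : R) :
  f @ F --> l -> l != 0 -> \forall x \near F, Num.sg (f x) = Num.sg l.
Proof.
move=> fl; rewrite neq_lt => /orP[l0|l0].
  by near do rewrite (ltr0_sg l0) ltr0_sg //; apply: (cvgr_lt l).
by near do rewrite (gtr0_sg l0) gtr0_sg //; apply: (cvgr_gt l).
Unshelve. all: by end_near. Qed.

Lemma derive_line (V W : normedModType R) (f : V -> W) (x v : V) :
  'D_v f x = 'D_1 (fun h : R => f (h *: v + x)) 0.
Proof.
rewrite /derive; set g1 := (fun h => _); set g2 := (fun h => _ *: (_ - f (0 *: v + x))).
suff -> : g1 = g2 by [].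
by rewrite funeqE /g1 /g2 => h /=; rewrite addr0 scale0r add0r [_%:A]mulr1.
Qed.

Lemma phi_sqr rho : phi rho ^+ 2 = `|fquartic rho|.
Proof. by rewrite sqr_sqrtr. Qed.

Lemma phi_gt0 rho : fquartic rho != 0 -> 0 < phi rho.
Proof. by move=> f0; rewrite sqrtr_gt0 normr_gt0. Qed.

(** Since f(rho) <> 0, the sign of f is constant near rho, so along the line phi^2 is near 0 a
    constant sign times a polynomial, whose linear coefficient is known. *)
Lemma derive_phi rho s : fquartic rho != 0 -> differentiable (phi : _ -> R) rho ->
  phi rho * 'd (phi : _ -> R) rho s = Num.sg (fquartic rho) *
   (mukai (cliff (Q rho.2) rho.1) s.1 + mukai (cliff (Q rho.1) rho.2) s.2).
Proof.
move=> f0 dphi; have [c2 [c3 fE]] := fquartic_line rho s.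
have Dphi : derivable (phi : _ -> R) rho s by exact: diff_derivable.
set X := (_ + _ : R) in fE *.
rewrite -deriveE //; apply: (mulfI (x := 2%:R)); first by rewrite pnatr_eq0.
have -> : 2%:R * (phi rho * 'D_s (phi : _ -> R) rho) =
    'D_s ((phi : _ -> R) * (phi : _ -> R)) rho.
  by rewrite deriveM //= /GRing.scale /=; ring.
rewrite derive_line.
pose p : {poly R} := Poly [:: fquartic rho; 2%:R * X; c2; c3; fquartic s].
have pE h : p.[h] = fquartic (rho + h *: s).
  by rewrite horner_Poly fE /=; ring.
rewrite (@near_eq_derive _ _ _ _ (Num.sg (fquartic rho) \*: horner p)); last first.
  have : \forall h \near (0 : R), Num.sg p.[h] = Num.sg (fquartic rho).
    apply: (@near_sgr _ (nbhs (0 : R)) _ (horner p) _ _ f0);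
    rewrite (_ : fquartic rho = p.[0]); first exact: continuous_horner.
    by rewrite pE scale0r addr0.
  apply: filterS => h sgE; rewrite /= -[LHS]/(phi _ * phi _) -expr2 phi_sqr.
  by rewrite addrC -pE -sgE normrEsg.
rewrite deriveZ; last exact: derivable_horner.
rewrite -derive1E -derivE horner_coef0 coef_deriv coef_Poly /= mulr1n /GRing.scale /=.
by ring.
Qed.

(** The directions (b, 0) and (0, b) are tested separately, and nondegeneracy of the pairing between
    odd and even forms concludes. The minus sign in the definition of rhat falls on the first
    component. *)
Lemma is_hatE rho rhat : is_even2 rho -> fquartic rho != 0 -> is_hat rho rhat ->
  phi rho *: rhat.2 = Num.sg (fquartic rho) *: cliff (Q rho.2) rho.1 /\
  phi rho *: rhat.1 = - (Num.sg (fquartic rho) *: cliff (Q rho.1) rho.2).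
Proof.
move=> [e1 e2] f0 [odd1 odd2 dphi hatP].
split; apply/eqP; rewrite -subr_eq0; apply/eqP; apply: mukai_nondegenerate.
- rewrite -scaleNr; apply: is_oddD; apply: is_oddZ => //; exact: cliff_even.
- move=> b eb; have := hatP (b, 0); rewrite -[is_even2 _]/(is_even b /\ is_even 0).
  move=> /(_ (conj eb _)) /(congr1 (fun x => phi rho * x)).
  rewrite derive_phi //= !mukai0r subr0 addr0 (mukaiDl (phi rho *: rhat.2)) mukaiNl !mukaiZl => <-.
    by rewrite subrr.
  by move=> A _; rewrite coef_form0.
- rewrite opprK; apply: is_oddD; apply: is_oddZ => //; exact: cliff_even.
- move=> b eb; have := hatP (0, b); rewrite -[is_even2 _]/(is_even 0 /\ is_even b).
  move=> /(_ (conj _ eb)) /(congr1 (fun x => phi rho * x)).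
  rewrite derive_phi //= !mukai0r sub0r add0r (mukaiDl (phi rho *: rhat.1))
    opprK !mukaiZl mulrN => ->.
    by rewrite subrr.
  by move=> A _; rewrite coef_form0.
Qed.

End HatForms.

(** * Derived brackets *)

Section Derivatives.
Local Open Scope classical_set_scope.
Context {R : realType}.

Lemma is_derive_linear (U V W : normedModType R) (L : V -> W) (f : U -> V)
    (x v : U) (df : V) : linear L -> continuous L ->
  is_derive x v f df -> is_derive x v (L \o f) (L df).
Proof.
move=> lL cL [df_cvg dfE].
have LB a b : L (a - b) = L a - L b.
  by rewrite -scaleN1r addrC lL scaleN1r addrC.
have L0 : L 0 = 0 by rewrite -(subrr 0) LB subrr.
have LZ k a : L (k *: a) = k *: L a by rewrite -[k *: a]addr0 lL L0 addr0.
suff H : (fun h : R => h^-1 *: ((L \o f \o shift x) (h *: v) - L (f x))) @ 0^' --> L df.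
  by apply: DeriveDef; [apply/cvg_ex; exists (L df)|exact: cvg_lim H].
rewrite (_ : (fun h : R => _) =
  L \o (fun h : R => h^-1 *: ((f \o shift x) (h *: v) - f x))); last first.
  by apply/funext => h /=; rewrite LZ LB.
by apply: continuous_cvg; [exact: cL|rewrite -dfE; exact: df_cvg].
Qed.

Lemma is_derive_mx (U : normedModType R) m n (f : U -> 'M[R]_(m, n)) (x v : U)
    (df : 'M[R]_(m, n)) :
  (forall i j, is_derive x v (fun y => f y i j) (df i j)) -> is_derive x v f df.
Proof.
move=> fE; have f_der : derivable f x v by apply/derivable_mxP => i j; case: (fE i j).
apply: DeriveDef => //; rewrite derive_mx //; apply/matrixP => i j.
by rewrite mxE; case: (fE i j).
Qed.

Lemma is_derive_mxE (U : normedModType R) m n (f : U -> 'M[R]_(m, n)) (x v : U)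
    (df : 'M[R]_(m, n)) i j :
  is_derive x v f df -> is_derive x v (fun y => f y i j) (df i j).
Proof.
case=> f_der <-; rewrite derive_mx // mxE; apply: derivableP.
by move/derivable_mxP: f_der.
Qed.

Lemma is_derive_bigsum (U V : normedModType R) (I : Type) (r : seq I)
    (f : I -> U -> V) (x v : U) (df : I -> V) :
  (forall i, is_derive x v (f i) (df i)) ->
  is_derive x v (fun y => \sum_(i <- r) f i y) (\sum_(i <- r) df i).
Proof.
move=> fE; elim: r => [|i r IHr].
  rewrite big_nil (_ : (fun y => _) = cst 0); first exact: is_derive_cst.
  by apply/funext => y; rewrite big_nil.
rewrite big_cons (_ : (fun y => _) = f i \+ (fun y => \sum_(i <- r) f i y)).
  exact: is_deriveD.
by apply/funext => y; rewrite big_cons.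
Qed.

Lemma is_derive_mul (U : normedModType R) (f g : U -> R) (x v : U) (df dg : R) :
  is_derive x v f df -> is_derive x v g dg ->
  is_derive x v (fun y => f y * g y) (df * g x + f x * dg).
Proof.
move=> hf hg; have := is_deriveM hf hg; rewrite /GRing.scale /= addrC [g x * df]mulrC.
exact.
Qed.

Lemma is_derive_scale (U : normedModType R) (k : R) (f : U -> R) (x v : U) (df : R) :
  is_derive x v f df -> is_derive x v (fun y => k * f y) (k * df).
Proof. by move=> hf; exact: (is_deriveZ k hf). Qed.

Section Forms.
Context {n : nat} {U : normedModType R}.
Implicit Types (a b : U -> form R n) (u w : U -> gvec R n) (x v : U).

Lemma is_derive_coef a x v da A :
  is_derive x v a da -> is_derive x v (fun y => coef (a y) A) (coef da A).
Proof. exact: is_derive_mxE. Qed.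

Lemma is_derive_form a x v da :
  (forall A, is_derive x v (fun y => coef (a y) A) (coef da A)) -> is_derive x v a da.
Proof.
move=> aE; apply: is_derive_mx => i j; rewrite ord1.
by have := aE (enum_val j); rewrite /coef enum_valK.
Qed.

Lemma is_derive_fst u x v du :
  is_derive x v u du -> is_derive x v (fun y => (u y).1) du.1.
Proof. by apply: is_derive_linear => // z; exact: cvg_fst. Qed.

Lemma is_derive_snd u x v du :
  is_derive x v u du -> is_derive x v (fun y => (u y).2) du.2.
Proof. by apply: is_derive_linear => // z; exact: cvg_snd. Qed.

Lemma is_derive_slot u x v du i e :
  is_derive x v u du -> is_derive x v (fun y => slot (u y) i e) (slot du i e).
Proof.
move=> hu; rewrite /slot; case: e; apply: is_derive_mxE.
  exact: is_derive_snd.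
exact: is_derive_fst.
Qed.

Lemma is_derive_cliff u a x v du da : is_derive x v u du -> is_derive x v a da ->
  is_derive x v (fun y => cliff (u y) (a y)) (cliff du (a x) + cliff (u x) da).
Proof.
move=> hu ha; apply: is_derive_form => A.
rewrite (_ : (fun y => _) = fun y => \sum_i sgn i A *
  (slot (u y) i (i \in A) * coef (a y) (flip i A))); last first.
  by apply/funext => y; rewrite coef_cliffE; apply: eq_bigr => i _; rewrite mulrA.
rewrite (_ : coef _ _ = \sum_i sgn i A * (slot du i (i \in A) * coef (a x) (flip i A) +
    slot (u x) i (i \in A) * coef da (flip i A))); last first.
  rewrite coefD !coef_cliffE -big_split; apply: eq_bigr => i _ /=; ring.
apply: is_derive_bigsum => i; apply: is_derive_scale; apply: is_derive_mul.
  exact: is_derive_slot.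
exact: is_derive_coef.
Qed.

Lemma is_derive_pairing (X xi : U -> 'rV[R]_n) x v dX dxi :
  is_derive x v X dX -> is_derive x v xi dxi ->
  is_derive x v (fun y => pairing (X y) (xi y)) (pairing dX (xi x) + pairing (X x) dxi).
Proof.
move=> hX hxi; rewrite /pairing -big_split /=; apply: is_derive_bigsum => i.
by apply: is_derive_mul; exact: is_derive_mxE.
Qed.

Lemma is_derive_ip u w x v du dw : is_derive x v u du -> is_derive x v w dw ->
  is_derive x v (fun y => ip (u y) (w y)) (ip du (w x) + ip (u x) dw).
Proof.
move=> hu hw; rewrite [X in is_derive _ _ _ X](_ : _ = 2%:R^-1 *
  ((pairing du.1 (w x).2 + pairing (u x).1 dw.2) +
   (pairing dw.1 (u x).2 + pairing (w x).1 du.2))); last by rewrite /ip; ring.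
apply: is_derive_scale; apply: is_deriveD; apply: is_derive_pairing;
  by [exact: is_derive_fst|exact: is_derive_snd].
Qed.

End Forms.

(** * Dorfman and Courant brackets in coordinates *)

Section Courant.
Context {n : nat}.
Implicit Types (a b : 'rV[R]_n -> form R n) (u w : 'rV[R]_n -> gvec R n) (x : 'rV[R]_n).

Definition all_partials {V : normedModType R} (f : 'rV[R]_n -> V) x : Prop :=
  forall i, derivable f x (basis_vec i).

Lemma is_partial {V : normedModType R} (f : 'rV[R]_n -> V) x i :
  all_partials f x -> is_derive x (basis_vec i) f (partial i f x).
Proof. by move=> hf; exact: derivableP. Qed.

Lemma ext_dE a x : ext_d a x = \sum_i cliff (0, basis_vec i) (partial i a x).
Proof.
by apply: eq_bigr => i _; rewrite cliff_covec.
Qed.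

Lemma all_partials_cliff u a x : all_partials u x -> all_partials a x ->
  all_partials (fun y => cliff (u y) (a y)) x.
Proof.
by move=> hu ha i; case: (is_derive_cliff (is_partial i hu) (is_partial i ha)).
Qed.

Lemma partial_cliff u a x i : all_partials u x -> all_partials a x ->
  partial i (fun y => cliff (u y) (a y)) x =
  cliff (partial i u x) (a x) + cliff (u x) (partial i a x).
Proof.
by move=> hu ha; case: (is_derive_cliff (is_partial i hu) (is_partial i ha)).
Qed.

(** Cartan's formula for sections of T + T^*: the derivatives of a survive only through the
    anticommutator of u with dx_i, which is the i-th component of the vector part. *)
Lemma ext_d_cliff u a x : all_partials u x -> all_partials a x ->
  ext_d (fun y => cliff (u y) (a y)) x + cliff (u x) (ext_d a x) =
  \sum_i (cliff (0, basis_vec i) (cliff (partial i u x) (a x)) +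
          (u x).1 0 i *: partial i a x).
Proof.
move=> hu ha; rewrite !ext_dE cliff_sumr -big_split /=; apply: eq_bigr => i _.
rewrite partial_cliff // cliffDr -addrA clifford ipC ip_basis2.
by rewrite mulrA divff ?pnatr_eq0 // mul1r.
Qed.

(** The bracket that is not skew-symmetric: for u = w only the last term remains, and it is d(u,
    u). *)
Definition dorfman u w x : gvec R n :=
  \sum_i ((u x).1 0 i *: partial i w x - (w x).1 0 i *: partial i u x +
          (2%:R * ip (partial i u x) (w x)) *: (0, basis_vec i)).

Lemma cliff_lin3 (k l m : R) (p q r : gvec R n) (f : form R n) :
  cliff (k *: p - l *: q + m *: r) f = k *: cliff p f - l *: cliff q f + m *: cliff r f.
Proof. by rewrite cliffDl (cliffDl (k *: p)) cliffNl !cliffZl. Qed.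

(* The Dorfman bracket is the derived bracket [[d, u], w] on forms. *)
Lemma cliff_dorfman u w a x :
  all_partials u x -> all_partials w x -> all_partials a x ->
  cliff (dorfman u w x) (a x) =
  ext_d (fun y => cliff (u y) (cliff (w y) (a y))) x
  + cliff (u x) (ext_d (fun y => cliff (w y) (a y)) x)
  - cliff (w x) (ext_d (fun y => cliff (u y) (a y)) x + cliff (u x) (ext_d a x)).
Proof.
move=> hu hw ha; have hwa := all_partials_cliff hw ha.
rewrite !ext_d_cliff // cliff_suml cliff_sumr -sumrB; apply: eq_bigr => i _.
have anti : cliff (0, basis_vec i) (cliff (partial i u x) (cliff (w x) (a x))) =
    (2%:R * ip (partial i u x) (w x)) *: cliff (0, basis_vec i) (a x) -
    ((w x).1 0 i *: cliff (partial i u x) (a x) -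
     cliff (w x) (cliff (0, basis_vec i) (cliff (partial i u x) (a x)))).
  have two0 : (2%:R : R) != 0 by rewrite pnatr_eq0.
  rewrite (cliffC (partial i u x)) (cliffDr _ (_ *: _)) cliffZr cliffNr (cliffC (0, _) (w x)).
  by rewrite (ipC (0, _)) ip_basis2 (mulVKf two0 ((w x).1 0 i)).
rewrite anti partial_cliff // (cliffDr (w x) _ (_ *: _)) cliffZr.
rewrite cliff_lin3.
have combine (X Y c : R) (p q r s t : form R n) :
    X *: r - Y *: s + c *: t = c *: t - (Y *: s - p) + X *: (r + q) - (p + X *: q).
  by apply/rowP => j; rewrite !mxE; ring.
exact: combine.
Qed.

(** The vector parts agree. In the covector parts the discrepancy consists of the four pairings that
    make up the derivative of (u, w); the half in [ip] matches the half in the Courant bracket. *)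
Lemma courantE u w x : all_partials u x -> all_partials w x ->
  courant u w x = dorfman u w x - (0, grad (fun y => ip (u y) (w y)) x).
Proof.
move=> hu hw.
have D1 (z : 'rV[R]_n -> gvec R n) i (hz : all_partials z x) :
    partial i (fun y => (z y).1) x = (partial i z x).1.
  by case: (is_derive_fst (is_partial i hz)).
have D2 (z : 'rV[R]_n -> gvec R n) i (hz : all_partials z x) :
    partial i (fun y => (z y).2) x = (partial i z x).2.
  by case: (is_derive_snd (is_partial i hz)).
have dorf1 : (dorfman u w x).1 =
    \sum_i ((u x).1 0 i *: (partial i w x).1 - (w x).1 0 i *: (partial i u x).1).
  rewrite /dorfman (big_morph (fun v : gvec R n => v.1) (id1 := 0) (op1 := +%R)) //.
  by apply: eq_bigr => i _; rewrite /= scaler0 addr0.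
have dorf2 : (dorfman u w x).2 =
    \sum_i ((u x).1 0 i *: (partial i w x).2 - (w x).1 0 i *: (partial i u x).2 +
          (2%:R * ip (partial i u x) (w x)) *: basis_vec i).
  by rewrite /dorfman (big_morph (fun v : gvec R n => v.2) (id1 := 0) (op1 := +%R)).
have grad_ip i : partial i (fun y => ip (u y) (w y)) x =
    ip (partial i u x) (w x) + ip (u x) (partial i w x).
  by case: (is_derive_ip (is_partial i hu) (is_partial i hw)).
have sum3 (f g c : 'I_n -> R) i :
    \sum_j (f j - g j + c j * (i == j)%:R) = \sum_j f j - \sum_j g j + c i.
  rewrite big_split sumrB; congr (_ + _); rewrite (bigD1 i) //= eqxx mulr1 big1 ?addr0 // => j ji.
  by rewrite eq_sym (negbTE ji) mulr0.
have rowB (p q : 'rV[R]_n) i : (p - q) 0 i = p 0 i - q 0 i by rewrite !mxE.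
have rowBBZ (p q r : 'rV[R]_n) k i : (p - q - k *: r) 0 i = p 0 i - q 0 i - k * r 0 i.
  by rewrite !mxE.
have gradE f i : grad f x 0 i = partial i f x by rewrite mxE.
have grad_pair i :
    partial i (fun y => pairing (u y).1 (w y).2 - pairing (w y).1 (u y).2) x =
    (pairing (partial i u x).1 (w x).2 + pairing (u x).1 (partial i w x).2) -
    (pairing (partial i w x).1 (u x).2 + pairing (w x).1 (partial i u x).2).
  apply: (@derive_val _ _ _ _ _ _ _ (is_deriveB
    (is_derive_pairing (is_derive_fst (is_partial i hu)) (is_derive_snd (is_partial i hw)))
    (is_derive_pairing (is_derive_fst (is_partial i hw)) (is_derive_snd (is_partial i hu))))).
have lieE (p q : 'rV[R]_n -> gvec R n) i (hp : all_partials p x) (hq : all_partials q x) :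
    lie_form (fun y => (p y).1) (fun y => (q y).2) x 0 i =
    \sum_j (p x).1 0 j * (partial j q x).2 0 i + pairing (partial i p x).1 (q x).2.
  rewrite mxE big_split /=; congr (_ + _); apply: eq_bigr => j _; first by rewrite D2.
  by rewrite D1 // mulrC.
have dorf2i i : (dorfman u w x).2 0 i = \sum_j (u x).1 0 j * (partial j w x).2 0 i -
    \sum_j (w x).1 0 j * (partial j u x).2 0 i + 2%:R * ip (partial i u x) (w x).
  rewrite dorf2 summxE; transitivity (\sum_j ((u x).1 0 j * (partial j w x).2 0 i -
      (w x).1 0 j * (partial j u x).2 0 i + 2%:R * ip (partial j u x) (w x) * (i == j)%:R)).
    have entry (X Y c : R) (p q : 'rV[R]_n) j :
        (X *: p - Y *: q + c *: basis_vec j) 0 i = X * p 0 i - Y * q 0 i + c * (i == j)%:R.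
      by rewrite !mxE eqxx.
    by apply: eq_bigr => j _; exact: entry.
  exact: (sum3 (fun j => (u x).1 0 j * (partial j w x).2 0 i)
    (fun j => (w x).1 0 j * (partial j u x).2 0 i)
    (fun j => 2%:R * ip (partial j u x) (w x)) i).
congr pair.
  by rewrite /= oppr0 addr0 dorf1; apply: eq_bigr => i _; rewrite !D1.
apply/rowP => i.
transitivity (lie_form (fun y => (u y).1) (fun y => (w y).2) x 0 i -
  lie_form (fun y => (w y).1) (fun y => (u y).2) x 0 i - 2%:R^-1 *
  partial i (fun y => pairing (u y).1 (w y).2 - pairing (w y).1 (u y).2) x).
  by rewrite /courant /= rowBBZ gradE.
transitivity ((dorfman u w x).2 0 i - partial i (fun y => ip (u y) (w y)) x); last first.
  by rewrite /= rowB gradE.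
rewrite !lieE // grad_ip grad_pair dorf2i /ip.
have combine (A B P1 P2 P3 P4 : R) :
    A + P1 - (B + P3) - 2%:R^-1 * (P1 + P2 - (P3 + P4)) =
    A - B + 2%:R * (2%:R^-1 * (P1 + P4)) - (2%:R^-1 * (P1 + P4) + 2%:R^-1 * (P2 + P3)).
  by field.
exact: combine.
Qed.

End Courant.

End Derivatives.

(** * Smooth functions *)

Section Smoothness.
Local Open Scope classical_set_scope.
Context {R : realType}.

Lemma is_derive_comp1 (U : normedModType R) (f : U -> R) (g : R -> R) (x v : U) (df dg : R) :
  is_derive x v f df -> is_derive (f x) 1 g dg -> is_derive x v (g \o f) (dg * df).
Proof.
move=> [f_der fE] hg.
have hl : is_derive (0 : R) 1 (fun h : R => f (h *: v + x)) df.
  by apply: DeriveDef; [exact: ((derivable1P _ _ _).1 f_der)|rewrite -derive_line].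
have hg' : is_derive (f (0 *: v + x)) 1 g dg by rewrite scale0r add0r.
have [c_der cE] := is_derive1_comp hg' hl.
by apply: DeriveDef; [exact: ((derivable1P _ _ _).2 c_der)|rewrite derive_line].
Qed.

Lemma is_derive_inv (U : normedModType R) (f : U -> R) (x v : U) (df : R) : f x != 0 ->
  is_derive x v f df -> is_derive x v (fun y => (f y)^-1) (- ((f x)^-1 * (f x)^-1 * df)).
Proof.
move=> fx0 [f_der fE]; apply: DeriveDef; first exact: derivableV.
by rewrite deriveV // fE /GRing.scale /= expr2 invfM mulNr.
Qed.

(** The derivative is expressed through the function itself and 1 / f, without the sign of f, so
    that the induction for smoothness closes up. *)
Lemma is_derive_invsqrt (U : normedModType R) (f : U -> R) (x v : U) (df : R) :
  f x != 0 -> {for x, continuous f} -> is_derive x v f df ->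
  is_derive x v (fun y => (Num.sqrt `|f y|)^-1)
    (- (2%:R^-1 * (Num.sqrt `|f x|)^-1 * (f x)^-1 * df)).
Proof.
(* Near x the sign of f is constantly e, so |f| may be replaced by e f, to which the chain rule
   applies. *)
move=> fx0 fc hf; pose e := Num.sg (f x).
have efx : e * f x = `|f x| by rewrite normrEsg.
have efx0 : 0 < e * f x by rewrite efx normr_gt0.
have s0 : Num.sqrt (e * f x) != 0 by rewrite gt_eqF // sqrtr_gt0.
have h1 := is_derive_comp1 (is_derive_scale e hf) (is_derive1_sqrt efx0).
have h2 := @is_derive_inv _ (fun y => Num.sqrt (e * f y)) _ _ _ s0 h1.
apply: (@near_eq_is_derive _ _ _ (fun y => (Num.sqrt (e * f y))^-1)).
  have sgE : \forall y \near x, Num.sg (f y) = e by exact: near_sgr fc fx0.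
  by near=> y; rewrite normrEsg (near sgE y).
apply: (@is_derive_eq _ _ _ _ _ _ _ _ h2); rewrite -efx.
have e2 : e * e = 1 by rewrite -expr2 sqr_sg fx0.
have e0 : e != 0 by rewrite sgr_eq0.
have sq : Num.sqrt (e * f x) * Num.sqrt (e * f x) = e * f x by rewrite -expr2 sqr_sqrtr // ltW.
rewrite invfM; congr (- _).
have -> : (Num.sqrt (e * f x))^-1 / Num.sqrt (e * f x) = e * (f x)^-1.
  by rewrite -invfM sq invfM; congr (_ * _); apply: (mulfI e0); rewrite e2 mulfV.
rewrite (_ : e / f x * (2^-1 / Num.sqrt (e * f x) * (e * df)) =
   (e * e) * (2^-1 / Num.sqrt (e * f x) / f x * df)); last by ring.
by rewrite e2 mul1r.
Unshelve. all: by end_near. Qed.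

Lemma gvec_sum m (u : gvec R m) : u =
  \sum_i u.1 0 i *: (basis_vec i, 0) + \sum_i u.2 0 i *: (0, basis_vec i).
Proof.
case: u => X xi /=; rewrite [LHS](_ : _ = (X, 0) + (0, xi)); last first.
  by congr pair; rewrite ?addr0 ?add0r.
rewrite {1}[X]row_sum_delta {1}[xi]row_sum_delta; congr (_ + _).
  rewrite (big_morph (fun p : 'rV[R]_m => (p, 0) : gvec R m) (id1 := 0) (op1 := +%R)) //.
    by apply: eq_bigr => i _; congr pair; rewrite scaler0.
  by move=> p q; congr pair; rewrite addr0.
rewrite (big_morph (fun p : 'rV[R]_m => (0, p) : gvec R m) (id1 := 0) (op1 := +%R)) //.
  by apply: eq_bigr => i _; congr pair; rewrite scaler0.
by move=> p q; congr pair; rewrite addr0.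
Qed.

Section Ck.
Context {n : nat} (U : set 'rV[R]_n).
Hypothesis openU : open U.

Lemma Ck_continuous (V : normedModType R) k (f : 'rV[R]_n -> V) x :
  Ck k U f -> U x -> {for x, continuous f}.
Proof. by case: k => [|k] [fc _]; exact: fc. Qed.

Lemma Ck_cvg (V : normedModType R) k (f : 'rV[R]_n -> V) x :
  Ck k U f -> U x -> f y @[y --> x] --> f x.
Proof. exact: Ck_continuous. Qed.

Lemma Ck_derivable (V : normedModType R) k (f : 'rV[R]_n -> V) x :
  Ck k.+1 U f -> U x -> all_partials f x.
Proof. by move=> [_ fd] Ux i; exact: (fd i).1. Qed.

Lemma Ck_partial (V : normedModType R) k (f : 'rV[R]_n -> V) i :
  Ck k.+1 U f -> Ck k U (partial i f).
Proof. by move=> [_ fd]; exact: (fd i).2. Qed.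

Lemma Ck_weaken (V : normedModType R) k (f : 'rV[R]_n -> V) : Ck k.+1 U f -> Ck k U f.
Proof.
elim: k f => [|k IHk] f; first by case.
move=> [fc fd]; split=> // i; split; first exact: (fd i).1.
by apply: IHk; exact: (fd i).2.
Qed.

Lemma near_eq_on (V : Type) (f g : 'rV[R]_n -> V) x :
  (forall y, U y -> f y = g y) -> U x -> \forall y \near x, f y = g y.
Proof.
move=> fg Ux; have : \forall y \near x, U y by apply: open_nbhs_nbhs; split.
by apply: filterS => y; exact: fg.
Qed.

Lemma Ck_ext (V : normedModType R) k (f g : 'rV[R]_n -> V) :
  (forall x, U x -> f x = g x) -> Ck k U f -> Ck k U g.
Proof.
elim: k f g => [|k IHk] f g fg [fc fd].
  split=> // x Ux; rewrite /prop_for /continuous_at -(fg x Ux).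
  exact: (cvg_trans (near_eq_cvg (near_eq_on fg Ux)) (fc x Ux)).
split.
  move=> x Ux; rewrite /prop_for /continuous_at -(fg x Ux).
  exact: (cvg_trans (near_eq_cvg (near_eq_on fg Ux)) (fc x Ux)).
move=> i; split.
  by move=> x Ux; apply: (near_eq_derivable (near_eq_on fg Ux)); exact: (fd i).1.
apply: IHk (fd i).2 => x Ux; apply: near_eq_derive.
exact: near_eq_on.
Qed.

(** [Ck] speaks of the limit defining each partial derivative. On an open set any formula valid
    there may replace it, which is how the inductions on k proceed. *)
Lemma CkS (V : normedModType R) k (f : 'rV[R]_n -> V) (df : 'I_n -> 'rV[R]_n -> V) :
  (forall x, U x -> {for x, continuous f}) ->
  (forall i x, U x -> is_derive x (basis_vec i) f (df i x)) ->
  (forall i, Ck k U (df i)) -> Ck k.+1 U f.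
Proof.
move=> fc fd dfC; split=> // i; split; first by move=> x /(fd i) [].
by apply: Ck_ext (dfC i) => x /(fd i) [].
Qed.

Lemma Ck_cst (V : normedModType R) k (c : V) : Ck k U (cst c).
Proof.
elim: k c => [|k IHk] c; first by split=> // x _; exact: cst_continuous.
by apply: (CkS (df := fun _ => cst 0)) => // x _; exact: cst_continuous.
Qed.

Lemma Ck_linear (V W : normedModType R) (L : V -> W) k (f : 'rV[R]_n -> V) :
  linear L -> continuous L -> Ck k U f -> Ck k U (fun x => L (f x)).
Proof.
move=> lL cL; elim: k f => [|k IHk] f fC.
  by split=> // x Ux; apply: continuous_comp; [exact: Ck_continuous fC Ux|exact: cL].
apply: (CkS (df := fun i x => L (partial i f x))).
- by move=> x Ux; apply: continuous_comp; [exact: Ck_continuous fC Ux|exact: cL].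
- by move=> i x Ux; apply: is_derive_linear => //; exact/is_partial/(Ck_derivable fC Ux).
- by move=> i; apply: IHk; exact: Ck_partial.
Qed.

Lemma CkD (V : normedModType R) k (f g : 'rV[R]_n -> V) :
  Ck k U f -> Ck k U g -> Ck k U (fun x => f x + g x).
Proof.
elim: k f g => [|k IHk] f g fC gC.
  by split=> // x Ux; exact: (cvgD (Ck_cvg fC Ux) (Ck_cvg gC Ux)).
apply: (CkS (df := fun i x => partial i f x + partial i g x)).
- by move=> x Ux; exact: (cvgD (Ck_cvg fC Ux) (Ck_cvg gC Ux)).
- by move=> i x Ux; apply: is_deriveD;
    [exact/is_partial/(Ck_derivable fC)|exact/is_partial/(Ck_derivable gC)].
- by move=> i; apply: IHk; exact: Ck_partial.
Qed.

Lemma Ck_bigsum (V : normedModType R) k (I : Type) (r : seq I) (f : I -> 'rV[R]_n -> V) :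
  (forall i, Ck k U (f i)) -> Ck k U (fun x => \sum_(i <- r) f i x).
Proof.
move=> fC; elim: r => [|i r IHr].
  by apply: Ck_ext (Ck_cst k 0) => x _; rewrite big_nil.
by apply: Ck_ext (CkD (fC i) IHr) => x _; rewrite big_cons.
Qed.

Lemma CkM k (f g : 'rV[R]_n -> R) :
  Ck k U f -> Ck k U g -> Ck k U (fun x => f x * g x).
Proof.
elim: k f g => [|k IHk] f g fC gC.
  by split=> // x Ux; exact: (cvgM (Ck_cvg fC Ux) (Ck_cvg gC Ux)).
apply: (CkS (df := fun i x => partial i f x * g x + f x * partial i g x)).
- by move=> x Ux; exact: (cvgM (Ck_cvg fC Ux) (Ck_cvg gC Ux)).
- by move=> i x Ux; apply: is_derive_mul;
    [exact/is_partial/(Ck_derivable fC)|exact/is_partial/(Ck_derivable gC)].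
- by move=> i; apply: CkD; apply: IHk; try exact: Ck_partial; exact: Ck_weaken.
Qed.

Lemma CkZ k (c : R) (f : 'rV[R]_n -> R) : Ck k U f -> Ck k U (fun x => c * f x).
Proof. by move=> fC; apply: CkM fC; exact: Ck_cst. Qed.

Lemma CkV k (f : 'rV[R]_n -> R) : (forall x, U x -> f x != 0) ->
  Ck k U f -> Ck k U (fun x => (f x)^-1).
Proof.
move=> f0; elim: k f f0 => [|k IHk] f f0 fC.
  by split=> // x Ux; exact: (cvgV (f0 x Ux) (Ck_cvg fC Ux)).
apply: (CkS (df := fun i x => - ((f x)^-1 * (f x)^-1 * partial i f x))).
- by move=> x Ux; exact: (cvgV (f0 x Ux) (Ck_cvg fC Ux)).
- by move=> i x Ux; apply: is_derive_inv; [exact: f0|exact/is_partial/(Ck_derivable fC)].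
- have fV : Ck k U (fun x => (f x)^-1) by apply: IHk => //; exact: Ck_weaken.
  move=> i; apply: Ck_ext (CkZ (-1) (CkM (CkM fV fV) (Ck_partial i fC))) => x _.
  by rewrite mulN1r.
Qed.

Lemma Ck_invsqrt k (f : 'rV[R]_n -> R) : (forall x, U x -> f x != 0) ->
  Ck k U f -> Ck k U (fun x => (Num.sqrt `|f x|)^-1).
Proof.
have cont (g : 'rV[R]_n -> R) x : {for x, continuous g} -> g x != 0 ->
    {for x, continuous (fun x : 'rV[R]_n => (Num.sqrt `|g x|)^-1)}.
  move=> gc g0; have s0 : Num.sqrt `|g x| != 0 by rewrite gt_eqF // sqrtr_gt0 normr_gt0.
  have gn : `|g y| @[y --> x] --> `|g x| by exact: (cvg_norm gc).
  have gs : Num.sqrt `|g y| @[y --> x] --> Num.sqrt `|g x|.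
    by apply: (@continuous_cvg _ _ _ _ _ _ Num.sqrt _ _ gn); exact: sqrt_continuous.
  exact: (cvgV s0 gs).
move=> f0; elim: k f f0 => [|k IHk] f f0 fC.
  by split=> // x Ux; apply: cont; [exact: Ck_continuous fC Ux|exact: f0].
apply: (CkS (df := fun i x => - (2%:R^-1 * (Num.sqrt `|f x|)^-1 * (f x)^-1 * partial i f x))).
- by move=> x Ux; apply: cont; [exact: Ck_continuous fC Ux|exact: f0].
- move=> i x Ux; apply: is_derive_invsqrt; [exact: f0|exact: Ck_continuous fC Ux|].
  exact/is_partial/(Ck_derivable fC).
- have fV : Ck k U (fun x => (f x)^-1) by apply: CkV => //; exact: Ck_weaken.
  have fS : Ck k U (fun x => (Num.sqrt `|f x|)^-1) by apply: IHk => //; exact: Ck_weaken.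
  move=> i; apply: Ck_ext (CkZ (- 2%:R^-1) (CkM (CkM fS fV) (Ck_partial i fC))) => x _.
  by ring.
Qed.

Lemma Ck_gvec m k (u : 'rV[R]_n -> gvec R m) :
  (forall i, Ck k U (fun x => (u x).1 0 i)) -> (forall i, Ck k U (fun x => (u x).2 0 i)) ->
  Ck k U u.
Proof.
move=> u1 u2.
have scale_basis (e : gvec R m) (f : 'rV[R]_n -> R) : Ck k U f -> Ck k U (fun x => f x *: e).
  apply: (Ck_linear (L := fun r : R => r *: e)); last exact: scalel_continuous.
  by move=> c r s; rewrite scalerDl scalerA.
apply: Ck_ext (CkD (Ck_bigsum (index_enum 'I_m) (fun i => scale_basis (basis_vec i, 0) _ (u1 i)))
  (Ck_bigsum (index_enum 'I_m) (fun i => scale_basis (0, basis_vec i) _ (u2 i)))) => x _.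
exact/esym/gvec_sum.
Qed.

Lemma Ck_coef m k (a : 'rV[R]_n -> form R m) A : Ck k U a -> Ck k U (fun x => coef (a x) A).
Proof.
apply: (Ck_linear (L := fun b : form R m => coef b A));
  last by move=> b; exact: matrix_normedtype.coord_continuous.
by move=> c b d; rewrite coefD coef_formZ.
Qed.

Lemma Ck_mukai_cliff m k (e : gvec R m) (a b : 'rV[R]_n -> form R m) :
  Ck k U a -> Ck k U b -> Ck k U (fun x => mukai (cliff e (a x)) (b x)).
Proof.
move=> aC bC.
apply: Ck_ext (_ : Ck k U (fun x => \sum_A \sum_i (msgn A * sgn i A * slot e i (i \in A)) *
   (coef (a x) (flip i A) * coef (b x) (~: A)))) => [x _|].
  rewrite mukaiE; apply: eq_bigr => A _; rewrite coef_cliffE mulr_sumr mulr_suml.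
  by apply: eq_bigr => i _; ring.
by do 2![apply: Ck_bigsum => ?]; apply: CkZ; apply: CkM; exact: Ck_coef.
Qed.

End Ck.

End Smoothness.

(** * Pull-backs *)

Section Pullback.
Context {R : realType} {n : nat}.
Implicit Types (a b c : form R n) (u v w : gvec R n) (A B : {set 'I_n}) (i j : 'I_n).
Implicit Types (J : 'M[R]_n) (X eta : 'rV[R]_n).

(** Products of covectors written as Clifford words applied to 1, so that the anticommutation rules
    apply to pulled-back monomials. *)
Definition wedge_word (T : Type) (x : T -> 'rV[R]_n) (s : seq T) : form R n :=
  foldr (fun l a => cliff (0, x l) a) one_form0 s.

Lemma cliff_covecC X eta a : cliff (0, X) (cliff (0, eta) a) = - cliff (0, eta) (cliff (0, X) a).
Proof.
rewrite cliffC ipE big1 ?mulr0 ?scale0r ?sub0r // => i _.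
by rewrite !mxE mul0r mul0r addr0.
Qed.

Lemma cliff_covec2 X a : cliff (0, X) (cliff (0, X) a) = 0.
Proof.
rewrite cliff_sqr ipE big1 ?mulr0 ?scale0r // => i _.
by rewrite !mxE !mul0r addr0.
Qed.

Lemma wedge_word_insert (T : Type) (x : T -> 'rV[R]_n) s1 l s2 :
  wedge_word x (s1 ++ l :: s2) =
  (-1) ^+ size s1 *: cliff (0, x l) (wedge_word x (s1 ++ s2)).
Proof.
elim: s1 => [|k s1 IHs] /=; first by rewrite expr0 scale1r.
by rewrite IHs cliffZr cliff_covecC exprS mulN1r scalerN scaleNr.
Qed.

Lemma coef_wedge_word (T : Type) (x : T -> 'rV[R]_n) s A :
  #|A| != size s -> coef (wedge_word x s) A = 0.
Proof.
elim: s A => [|k s IHs] A /=.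
  by rewrite cards_eq0 /one_form0 coef_mkform => /negbTE ->.
move=> As; rewrite coef_cliffE big1 // => i _; rewrite /slot /=.
case: ifPn => [iA|_]; last by rewrite mxE mulr0 mul0r.
rewrite IHs ?mulr0 // /flip iA; apply: contraNneq As => <-.
by rewrite [in X in X == _](cardsD1 i A) iA.
Qed.

Lemma enum_ord_split i : exists e1 e2, [/\ enum 'I_n = e1 ++ i :: e2,
  {in e1, forall j, (j < i)%N} & {in e2, forall j, (i < j)%N}].
Proof.
have : pairwise (fun j k : 'I_n => (j < k)%N) (enum 'I_n).
  rewrite -sorted_pairwise; last by move=> ? ? ?; exact: ltn_trans.
  by rewrite -(sorted_map (f := val) (e' := ltn)) val_enum_ord iota_ltn_sorted.
have : i \in enum 'I_n by rewrite mem_enum.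
case/splitPr => e1 e2; rewrite pairwise_cat => /and3P[/allrelP h1 _ /=].
case/andP => /allP h2 _; exists e1, e2; split=> // j je.
by apply: h1 => //; rewrite inE eqxx.
Qed.

(** The sign for moving the i-th factor to the front of a word is (-1) to the length of s1; the last
    clause identifies it with [sgn i A]. *)
Lemma enum_setU1 i A : i \notin A -> exists s1 s2,
  [/\ enum A = s1 ++ s2, enum (i |: A) = s1 ++ i :: s2 & size s1 = below i A].
Proof.
move=> iA; have [e1 [e2 [eE lt1 lt2]]] := enum_ord_split i.
have enumE (B : {set 'I_n}) : enum B = [seq j <- enum 'I_n | j \in B].
  by rewrite {2}/enum_mem filter_predT /enum_mem.
exists [seq j <- e1 | j \in A], [seq j <- e2 | j \in A]; split.
- by rewrite enumE eE filter_cat /= (negbTE iA).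
- rewrite enumE eE filter_cat /= !inE eqxx /=; congr (_ ++ _ :: _).
    by apply: eq_in_filter => j /lt1; rewrite !inE; case: eqP => // ->; rewrite ltnn.
  by apply: eq_in_filter => j /lt2; rewrite !inE; case: eqP => // ->; rewrite ltnn.
rewrite /below cardE enumE eE filter_cat /= !inE ltnn andbF size_cat.
rewrite [X in (_ + size X)%N](_ : _ = [::]) ?addn0.
  by congr size; apply: eq_in_filter => j /lt1; rewrite !inE => ->; rewrite andbT.
apply/eqP; rewrite -size_eq0 size_filter -leqn0 leqNgt -has_count; apply/hasPn => j /lt2.
by rewrite !inE => ij; rewrite ltnNge ltnW ?andbF.
Qed.

Lemma cliff_word_set (x : 'I_n -> 'rV[R]_n) i A :
  cliff (0, x i) (wedge_word x (enum A)) =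
  if i \in A then 0 else sgn i A *: wedge_word x (enum (flip i A)).
Proof.
case: ifPn => iA.
  have /enum_setU1 [s1 [s2 [_ eA _]]] : i \notin A :\ i by rewrite !inE eqxx.
  rewrite finset.setD1K // in eA.
  by rewrite eA wedge_word_insert cliffZr cliff_covec2 scaler0.
rewrite /flip (negbTE iA); have [s1 [s2 [-> -> s1E]]] := enum_setU1 iA.
by rewrite wedge_word_insert s1E scalerA sgn_mul scale1r.
Qed.

Lemma pullbackE J a :
  pullback J a = \sum_A coef a A *: wedge_word (fun l => (col l J)^T) (enum A).
Proof.
apply: eq_bigr => A _; congr (_ *: _).
elim: (enum A) => [|l s IHs]; first by rewrite big_nil.
by rewrite big_cons IHs -cliff_covec.
Qed.

Lemma pullbackD J a b : pullback J (a + b) = pullback J a + pullback J b.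
Proof. by rewrite -big_split; apply: eq_bigr => A _; rewrite coefD scalerDl. Qed.

Lemma pullbackZ J k a : pullback J (k *: a) = k *: pullback J a.
Proof. by rewrite scaler_sumr; apply: eq_bigr => A _; rewrite coef_formZ scalerA. Qed.

Lemma pullback0 J : pullback J 0 = 0.
Proof. by rewrite /pullback big1 // => A _; rewrite coef_form0 scale0r. Qed.

Lemma pullback_one J : pullback J one_form0 = one_form0.
Proof.
rewrite pullbackE (bigD1 finset.set0) //= big1 ?addr0 => [|A A0].
  by rewrite coef_mkform eqxx scale1r enum_set0.
by rewrite coef_mkform (negbTE A0) scale0r.
Qed.

Lemma pullback_cliff_covec J i a :
  cliff (0, (col i J)^T) (pullback J a) = pullback J (cliff (0, basis_vec i) a).
Proof.
rewrite !pullbackE cliff_sumr (reindex_inj (inv_inj (@flipK _ i))) /=.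
apply: eq_bigr => A _; rewrite cliffZr (cliff_word_set (fun l => (col l J)^T)).
rewrite coef_cliff_basis2 in_flip eqxx sgn_flip ltnn mul1r flipK.
by case: (i \in A); rewrite /= ?scalerA 1?mulrC // scaler0 scale0r.
Qed.

(** By induction on #|A|, each monomial dx_A is up to sign dx_i /\ dx_(A - i) for some i in A. The
    exterior algebra is thus generated from 1, and naturality need only be checked on generators. *)
Lemma form_ind (P : form R n -> Prop) : P one_form0 ->
  (forall k a b, P a -> P b -> P (k *: a + b)) ->
  (forall i a, P a -> P (cliff (0, basis_vec i) a)) -> forall a, P a.
Proof.
move=> P1 Plin Pdx; have P0 : P 0 by rewrite -(addNr one_form0) -scaleN1r; exact: Plin.
have PA A : P (dx A).
  have [m] := ubnP #|A|; elim: m A => // m IHm A.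
  have [-> _|[i iA]] := finset.set_0Vmem A; first exact: P1.
  rewrite ltnS => Am; rewrite (_ : dx A = sgn i A *: cliff (0, basis_vec i) (dx (A :\ i)) + 0).
    apply: Plin => //; apply: Pdx; apply: IHm; apply: leq_trans Am.
    by rewrite [leqRHS](cardsD1 i A) iA.
  apply: coef_inj => B; rewrite addr0 coef_formZ coef_cliff_basis2 !coef_mkform.
  have flipA : flip i A = A :\ i by rewrite /flip iA.
  rewrite -flipA (inj_eq (inv_inj (@flipK _ i))).
  case: eqP => [->|_]; first by rewrite iA mulr1 sgn_mul.
  by case: ifP; rewrite !mulr0.
move=> a; rewrite (dx_sum a); elim: (index_enum _) => [|A r IHr]; first by rewrite big_nil.
by rewrite big_cons; exact: Plin.
Qed.

Lemma cliff_vec_one X : cliff (X, 0) one_form0 = 0.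
Proof.
apply: coef_inj => A; rewrite coef_cliffE coef_form0 big1 // => i _.
rewrite /slot coef_mkform /=; case: ifPn => iA; first by rewrite mxE mulr0 mul0r.
rewrite (_ : (flip i A == finset.set0) = false) ?mulr0 //; apply/negbTE/finset.set0Pn.
by exists i; rewrite in_flip eqxx (negbTE iA).
Qed.

(** Contraction is characterized by killing 1 and by its anticommutators with covectors, and both
    conditions are compatible with pull-back. *)
Lemma pullback_cliff_vec J X a :
  cliff (X, 0) (pullback J a) = pullback J (cliff (X *m J, 0) a).
Proof.
elim/form_ind: a => [|k a b IHa IHb|i a IHa].
- by rewrite pullback_one !cliff_vec_one pullback0.
- by rewrite pullbackD pullbackZ !cliffDr !cliffZr pullbackD pullbackZ IHa IHb.
have eq_ip : ip (X, 0) (0, (col i J)^T) = ip (X *m J, 0) (0, basis_vec i).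
  rewrite ip_basis2 ipE; congr (_ * _); rewrite [RHS]mxE; apply: eq_bigr => j _.
  by rewrite /= [_^T _ _]mxE [col _ _ _ _]mxE mxE mul0r addr0.
rewrite -pullback_cliff_covec cliffC eq_ip IHa pullback_cliff_covec.
by rewrite -pullbackZ -(scaleN1r (pullback _ _)) -pullbackZ -pullbackD scaleN1r -cliffC.
Qed.

Lemma pullback_cliff J X eta a :
  cliff (X, eta *m J^T) (pullback J a) = pullback J (cliff (X *m J, eta) a).
Proof.
have split_gvec (Y xi : 'rV[R]_n) : (Y, xi) = (Y, 0) + (0, xi) :> gvec R n.
  by congr pair; rewrite ?addr0 ?add0r.
have covec_sum xi b : cliff (0, xi) b = \sum_i xi 0 i *: cliff (0, basis_vec i) b.
  rewrite {1}(gvec_sum (0, xi)) big1 ?add0r; last by move=> i _; rewrite /= mxE scale0r.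
  by rewrite cliff_suml; apply: eq_bigr => i _; rewrite cliffZl.
rewrite split_gvec cliffDl pullback_cliff_vec [in RHS]split_gvec cliffDl pullbackD.
congr (_ + _); rewrite (covec_sum eta).
rewrite (big_morph _ (pullbackD J) (pullback0 J)).
transitivity (cliff (\sum_i eta 0 i *: (0, (col i J)^T)) (pullback J a)).
  congr (cliff _ _); rewrite [RHS]surjective_pairing.
  rewrite !(big_morph (fun v : gvec R n => v.1) (id1 := 0) (op1 := +%R)) //.
  rewrite !(big_morph (fun v : gvec R n => v.2) (id1 := 0) (op1 := +%R)) //.
  congr pair; first by rewrite big1 // => i _; rewrite /= scaler0.
  by apply/rowP => k; rewrite summxE mxE; apply: eq_bigr => i _; rewrite !mxE.
rewrite cliff_suml; apply: eq_bigr => i _.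
by rewrite cliffZl pullback_cliff_covec pullbackZ.
Qed.

Lemma mono_ltn_ord_inj k (f : 'I_k -> 'I_n) : {mono f : p q / (p < q)%N} -> injective f.
Proof.
move=> fmono p q fpq; apply: val_inj.
by case: (ltngtP p q) => // [|]; rewrite -fmono fpq ltnn.
Qed.

Lemma below_imset k (f : 'I_k -> 'I_n) (i : 'I_k) :
  {mono f : p q / (p < q)%N} -> below (f i) [set f p | p in 'I_k] = i.
Proof.
move=> fmono; have finj := mono_ltn_ord_inj fmono.
rewrite belowE big_mkcond /= (bigID (mem [set f p | p in 'I_k])) /=.
rewrite [X in (_ + X)%N]big1 ?addn0; last by move=> j /negbTE ->; case: ifP.
rewrite big_imset /=; last by move=> p q _ _; exact: finj.
rewrite (eq_bigr (fun p : 'I_k => nat_of_bool (p < i)%N)); last first.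
  by move=> p _; rewrite fmono imset_f //; case: ifP.
rewrite -(big_mkcond (fun p : 'I_k => (p < i)%N) (fun=> 1%N)).
by rewrite -(big_ord_widen k (fun=> 1%N) (ltnW (ltn_ord i))) sum1_card card_ord.
Qed.

(* Laplace expansion along the first covector. *)
Lemma coef_wedge_word_det k (x : 'I_k -> 'rV[R]_n) (f : 'I_k -> 'I_n) :
  {mono f : p q / (p < q)%N} ->
  coef (wedge_word x (enum 'I_k)) [set f p | p in 'I_k] =
  \det (\matrix_(p, q) x q 0 (f p)).
Proof.
elim: k x f => [|k IHk] x f fmono.
  rewrite det_mx00 (size0nil (s := enum 'I_0)) ?size_enum_ord //= coef_mkform.
  rewrite (_ : [set f p | p in 'I_0] = finset.set0) ?eqxx //.
  by apply/finset.setP => i; rewrite inE; apply/negbTE/imsetP => -[[]].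
have finj := mono_ltn_ord_inj fmono.
rewrite (expand_det_col _ ord0) enum_ordSl /= coef_cliffE.
rewrite (bigID (mem [set f p | p in 'I_k.+1])) /= [X in _ + X]big1 ?addr0; last first.
  by move=> i /negbTE iA; rewrite /slot iA mxE mulr0 mul0r.
rewrite big_imset /=; last by move=> p q _ _; exact: finj.
apply: eq_bigr => p _; rewrite /slot imset_f //= /sgn below_imset // /cofactor mxE addn0.
rewrite mulrCA mulrA; congr (_ * _).
have -> : wedge_word x [seq lift ord0 l | l <- enum 'I_k] =
    wedge_word (fun l => x (lift ord0 l)) (enum 'I_k).
  by elim: (enum 'I_k) => //= l s ->.
have -> : flip (f p) [set f q | q in 'I_k.+1] = [set f (lift p q) | q in 'I_k].
  rewrite /flip imset_f //; apply/finset.setP => i; rewrite !inE.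
  apply/andP/imsetP => [[ifp /imsetP [q _ iE]]|[q _ ->]].
    have /unlift_some [r rE _] : p != q by apply: contraNneq ifp => ->; rewrite iE.
  by exists r => //; rewrite iE {1}rE.
  by rewrite (inj_eq finj) eq_sym neq_lift imset_f.
rewrite IHk.
  by congr (\det _); apply/matrixP => q r; rewrite !mxE.
move=> q r; by rewrite fmono !ltnNge leq_bump2.
Qed.

End Pullback.

(** * Naturality of the Mukai pairing, Q and phi *)

Section Naturality.
Context {R : realType}.

Lemma pairing_mulmx n (X eta : 'rV[R]_n) (J : 'M[R]_n) :
  pairing X (eta *m J^T) = pairing (X *m J) eta.
Proof.
rewrite /pairing; under eq_bigr => i _ do rewrite mxE mulr_sumr.
rewrite exchange_big; apply: eq_bigr => j _ /=; rewrite mxE mulr_suml.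
by apply: eq_bigr => i _; rewrite mxE; ring.
Qed.

(** The weight d serves two uses: d = 1 for changes of charts of sections, and d = det J for Q of
    pulled-back forms. *)
Lemma ip_natural n (J : 'M[R]_n) (d : R) (u w u' w' : gvec R n) :
  u.1 *m J = d *: u'.1 -> u.2 = d *: u'.2 *m J^T ->
  w.1 *m J = d *: w'.1 -> w.2 = d *: w'.2 *m J^T ->
  ip u w = d ^+ 2 * ip u' w'.
Proof.
have pairingZ k l (X xi : 'rV[R]_n) : pairing (k *: X) (l *: xi) = k * l * pairing X xi.
  by rewrite /pairing mulr_sumr; apply: eq_bigr => i _; rewrite !mxE; ring.
move=> u1 u2 w1 w2; rewrite /ip u2 w2 !pairing_mulmx u1 w1 !pairingZ; ring.
Qed.

Lemma top_pullback (J : 'M[R]_5) a :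
  coef (pullback J a) finset.setT = \det J * coef a finset.setT.
Proof.
rewrite pullbackE coef_form_sum (bigD1 finset.setT) //= big1 ?addr0 => [|A AT].
  rewrite coef_formZ mulrC; congr (_ * _); rewrite enum_setT -enumT.
  have idmono : {mono (@id 'I_5) : p q / (p < q)%N} by [].
  have := coef_wedge_word_det (fun l => (col l J)^T) idmono.
  rewrite (_ : [set id p | p in 'I_5] = finset.setT); last first.
    by apply/finset.setP => i; rewrite [RHS]inE; apply/imsetP; exists i.
  by move=> ->; congr (\det _); apply/matrixP => p q; rewrite !mxE.
rewrite coef_formZ coef_wedge_word ?mulr0 // -cardE neq_ltn; apply/orP; right.
by apply: proper_card; rewrite properT.
Qed.

Lemma mukai_one c : mukai one_form0 c = coef c [set: 'I_5]%SET :> R.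
Proof.
rewrite mukaiE (bigD1 finset.set0) //= big1 ?addr0 => [|A A0].
  by rewrite coef_mkform eqxx finset.setC0 msgnE big_set0 expr0 !mul1r.
by rewrite coef_mkform (negbTE A0) mulr0 mul0r.
Qed.

(** Self-adjointness moves the generators dx_i of a over to b. This reduces the claim to a = 1,
    where the pairing is the top coefficient and the determinant appears. *)
Lemma mukai_pullback (J : 'M[R]_5) a b :
  mukai (pullback J a) (pullback J b) = \det J * mukai a b.
Proof.
elim/(@form_ind R 5): a b => [|k a a' IHa IHa'|i a IHa] b.
- by rewrite pullback_one !mukai_one top_pullback.
- by rewrite pullbackD pullbackZ !mukaiDl !mukaiZl IHa IHa'; ring.
- by rewrite -pullback_cliff_covec mukai_cliff pullback_cliff_covec IHa -mukai_cliff.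
Qed.

Lemma ip_QB_pullback (J : 'M[R]_5) a b X eta :
  ip (QB (pullback J a) (pullback J b)) (X, eta *m J^T) = \det J * ip (QB a b) (X *m J, eta).
Proof. by rewrite !QBE pullback_cliff mukai_pullback. Qed.

Lemma QB_pullback1 (J : 'M[R]_5) a b :
  (QB (pullback J a) (pullback J b)).1 *m J = \det J *: (QB a b).1.
Proof.
have two0 : (2%:R^-1 : R) != 0 by rewrite invr_eq0 pnatr_eq0.
apply/rowP => i; apply: (mulfI two0).
have := ip_QB_pullback J a b 0 (basis_vec i).
rewrite mul0mx ip_basis2 /ip -[(0, _).2]/(basis_vec i *m J^T) pairing_mulmx.
rewrite [pairing (0, _).1 _](_ : _ = 0) ?addr0; last first.
  by rewrite /pairing big1 // => j _; rewrite mxE mul0r.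
have pairing_basis (Y : 'rV[R]_5) : pairing Y (basis_vec i) = Y 0 i.
  rewrite /pairing (bigD1 i) //= mxE !eqxx mulr1 big1 ?addr0 // => j ji.
  by rewrite mxE (negbTE ji) mulr0.
rewrite pairing_basis => ->; move: (QB a b).1 => X; rewrite mxE; ring.
Qed.

Lemma QB_pullback2 (J : 'M[R]_5) a b :
  (QB (pullback J a) (pullback J b)).2 = \det J *: (QB a b).2 *m J^T.
Proof.
have two0 : (2%:R^-1 : R) != 0 by rewrite invr_eq0 pnatr_eq0.
apply/rowP => i; apply: (mulfI two0).
have := ip_QB_pullback J a b (basis_vec i) 0.
rewrite mul0mx ip_basis1 => ->.
have pair0 (Y : 'rV[R]_5) : pairing Y 0 = 0.
  by rewrite /pairing big1 // => j _; rewrite mxE mulr0.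
have pairing_basis (Y : 'rV[R]_5) : pairing (basis_vec i) Y = Y 0 i.
  rewrite /pairing (bigD1 i) //= mxE !eqxx mul1r big1 ?addr0 // => j ji.
  by rewrite mxE (negbTE ji) mul0r.
rewrite /ip /= pair0 add0r -pairing_mulmx pairing_basis -scalemxAl [in RHS]mxE; ring.
Qed.

Lemma fquartic_pullback (J : 'M[R]_5) a b :
  fquartic (pullback J a, pullback J b) = \det J ^+ 2 * fquartic (a, b).
Proof.
have [h1 h2] := (QB_pullback1 J a a, QB_pullback2 J a a).
have [k1 k2] := (QB_pullback1 J b b, QB_pullback2 J b b).
exact: (ip_natural h1 h2 k1 k2).
Qed.

(** Taking the square root of f loses the sign of det J; positivity restores the transformation rule
    of a volume form. *)
Lemma phi_pullback (J : 'M[R]_5) a b : 0 < \det J ->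
  phi (pullback J a, pullback J b) = \det J * phi (a, b).
Proof.
move=> J0; rewrite /phi fquartic_pullback normrM sqrtrM ?normr_ge0 //.
by rewrite normrX sqrtr_sqr normr_id (gtr0_norm J0).
Qed.

End Naturality.

(** * Pointwise algebra of the triple v_1, h, v_2 *)

Section NormalizedTriple.
Context {R : realType}.
Variables (a b : form R 5) (v1 h v2 : gvec R 5).
Hypotheses (ea : is_even a) (eb : is_even b) (f0 : fquartic (a, b) != 0).
Hypotheses (Qa : Q a = phi (a, b) *: v1) (Qab : QB a b = phi (a, b) *: h)
  (Qb : Q b = phi (a, b) *: v2).

Let e : R := Num.sg (fquartic (a, b)).

Let phi0 : phi (a, b) != 0.
Proof. by rewrite gt_eqF // phi_gt0. Qed.

Let phi20 : phi (a, b) ^+ 2 != 0.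
Proof. by rewrite expf_neq0. Qed.

Let ip_scale (u w : gvec R 5) : ip (phi (a, b) *: u) (phi (a, b) *: w) = phi (a, b) ^+ 2 * ip u w.
Proof. by rewrite ipZl ipZr mulrA. Qed.

Lemma triple_gram : [/\ ip v1 v1 = 0, ip v1 h = 0, ip h v2 = 0, ip v2 v2 = 0 &
  ip v1 v2 = e /\ ip h h = - (2%:R^-1 * e)].
Proof.
have [g1 g2 g3] := Q_QB ea eb.
have ef : phi (a, b) ^+ 2 * e = fquartic (a, b).
  by rewrite phi_sqr /e mulrC -numEsg.
have fE : ip (phi (a, b) *: v1) (phi (a, b) *: v2) = fquartic (a, b) by rewrite -Qa -Qb.
move: (Q_null ea) (Q_null eb) g1 g2 g3.
rewrite Qa Qb Qab fE !ip_scale -ef.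
have cancel x : phi (a, b) ^+ 2 * x = 0 -> x = 0.
  by move/eqP; rewrite mulf_eq0 (negbTE phi20) => /eqP.
move=> /cancel n1 /cancel n2 /cancel n3 /cancel n4 n5.
split=> //; split; apply: (mulfI phi20); first by rewrite -ip_scale fE ef.
by rewrite n5; ring.
Qed.

Lemma triple_cliff : [/\ cliff v1 a = 0, cliff v2 b = 0,
  cliff h a = - (2%:R^-1 *: cliff v1 b) & cliff h b = - (2%:R^-1 *: cliff v2 a)].
Proof.
have half0 : (2%:R : R) != 0 by rewrite pnatr_eq0.
move: (cliff_Q ea) (cliff_Q eb) (cliff_Q_QB ea eb) (cliff_Q_QB eb ea).
rewrite (QBC b a) Qa Qb Qab !cliffZl => /eqP; rewrite scaler_eq0 (negbTE phi0) => /eqP -> /eqP.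
rewrite scaler_eq0 (negbTE phi0) => /eqP -> h1 h2; split=> //.
  apply: (scalerI phi0); rewrite scalerN [in RHS]scalerA mulrC -scalerA h1.
  by rewrite scalerN opprK (scalerA 2%:R^-1 2%:R) mulVf // scale1r.
apply: (scalerI phi0); rewrite scalerN [in RHS]scalerA mulrC -scalerA h2.
by rewrite scalerN opprK (scalerA 2%:R^-1 2%:R) mulVf // scale1r.
Qed.

(** These are the double products entering the brackets of (v_1, h), (v_1, v_2) and (h, v_2). The
    relations of [triple_cliff] reduce each to 0, a square or an anticommutator, which the Gram
    matrix evaluates. *)
Lemma triple_words :
  [/\ cliff v1 (cliff h a) = 0, cliff v1 (cliff h b) = - e *: a,
      cliff v1 (cliff v2 a) = (2%:R * e) *: a, cliff v1 (cliff v2 b) = 0 &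
      cliff h (cliff v2 a) = e *: b /\ cliff h (cliff v2 b) = 0].
Proof.
have [n1 n2 n3 n4 [n5 n6]] := triple_gram; have [c1 c2 c3 c4] := triple_cliff.
have two0 : (2%:R : R) != 0 by rewrite pnatr_eq0.
have v12a : cliff v1 (cliff v2 a) = (2%:R * e) *: a.
  by rewrite cliffC n5 c1 cliff0r subr0.
have v2a : cliff v2 a = - (2%:R *: cliff h b).
  by rewrite c4 scalerN opprK scalerA divff // scale1r.
split=> //.
- by rewrite c3 cliffNr cliffZr cliff_sqr n1 scale0r scaler0 oppr0.
- by rewrite c4 cliffNr cliffZr v12a scalerA mulrA mulVf // mul1r scaleNr.
- by rewrite c2 cliff0r.
- rewrite c2 cliff0r v2a cliffNr cliffZr cliff_sqr n6 scaleNr scalerN opprK scalerA.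
  by rewrite mulrA divff // mul1r.
Qed.

(** The Gram matrix is nondegenerate: pairing a relation with v_1, v_2 and h isolates the
    coefficient of v_2, v_1 and h respectively. *)
Lemma triple_free : free [:: v1; h; v2].
Proof.
have [n1 n2 n3 n4 [n5 n6]] := triple_gram.
have e0 : e != 0 by rewrite sgr_eq0.
have two0 : (2%:R^-1 : R) != 0 by rewrite invr_eq0 pnatr_eq0.
apply/(@freeP R _ 3 [tuple v1; h; v2]) => k; rewrite !big_ord_recl big_ord0 /= addr0.
set k0 := k ord0; set k1 := k (lift _ _); set k2 := k (lift _ _) => sum0.
have ip0 w : k0 * ip v1 w + (k1 * ip h w + k2 * ip v2 w) = 0.
  by rewrite -!ipZl -!ipDl sum0 ip0l.
have := ip0 v1; rewrite n1 (ipC h) n2 (ipC v2) n5 !mulr0 !add0r => /eqP.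
rewrite mulf_eq0 (negbTE e0) orbF => /eqP k2E.
have := ip0 v2; rewrite n5 n3 n4 !mulr0 !addr0 => /eqP.
rewrite mulf_eq0 (negbTE e0) orbF => /eqP k0E.
have := ip0 h; rewrite n2 n6 (ipC v2) n3 !mulr0 add0r addr0 => /eqP.
rewrite mulf_eq0 oppr_eq0 mulf_eq0 (negbTE e0) (negbTE two0) !orbF => /eqP k1E.
move=> i; have : i \in [:: ord0; lift ord0 ord0; lift ord0 (lift ord0 ord0)].
  by case: i => -[|[|[|]]].
by rewrite !inE => /or3P[] /eqP ->.
Qed.

End NormalizedTriple.

(** * Critical pairs on a manifold *)

Section LocalGeometry.
Local Open Scope classical_set_scope.
Context {R : realType}.

Lemma ext_d_near n (a b : 'rV[R]_n -> form R n) (c : R) x :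
  (\forall y \near x, a y = c *: b y) -> all_partials b x -> ext_d b x = 0 ->
  ext_d a x = 0.
Proof.
move=> ab hb db0; transitivity (c *: ext_d b x); last by rewrite db0 scaler0.
rewrite !ext_dE scaler_sumr.
apply: eq_bigr => i _; rewrite -cliffZr; congr (cliff _ _).
by rewrite /partial (near_eq_derive _ ab) deriveZ.
Qed.

Lemma grad_near_cst n (f : 'rV[R]_n -> R) (c : R) x :
  (\forall y \near x, f y = c) -> grad f x = 0.
Proof.
move=> fc; apply/rowP => i; rewrite !mxE /partial.
by rewrite (@near_eq_derive _ _ _ f (cst c)) // derive_cst.
Qed.

Lemma courant_eq0 (u w : 'rV[R]_5 -> gvec R 5) (a b : 'rV[R]_5 -> form R 5) x c :
  all_partials u x -> all_partials w x -> all_partials a x -> all_partials b x ->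
  fquartic (a x, b x) != 0 -> (\forall y \near x, ip (u y) (w y) = c) ->
  (forall r, r = a \/ r = b -> [/\ ext_d r x = 0, ext_d (fun y => cliff (u y) (r y)) x = 0,
     ext_d (fun y => cliff (w y) (r y)) x = 0 &
     ext_d (fun y => cliff (u y) (cliff (w y) (r y))) x = 0]) ->
  courant u w x = 0.
Proof.
move=> hu hw ha hb f0 ip_cst closed.
have dorf r : r = a \/ r = b -> all_partials r x -> cliff (dorfman u w x) (r x) = 0.
  move=> rab hr; have [r0 ur0 wr0 uwr0] := closed r rab.
  by rewrite cliff_dorfman // r0 ur0 wr0 uwr0 !cliff0r !addr0 cliff0r subr0.
rewrite courantE // (grad_near_cst ip_cst) subr0.
exact: (cliff_pair_inj f0 (dorf a (or_introl erefl) ha) (dorf b (or_intror erefl) hb)).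
Qed.

Lemma Ck_QB1 (U : set 'rV[R]_5) k (a b : 'rV[R]_5 -> form R 5) i : open U ->
  Ck k U a -> Ck k U b -> Ck k U (fun x => (QB (a x) (b x)).1 0 i).
Proof.
move=> openU aC bC.
apply: (Ck_ext openU _ (CkZ openU 2%:R (Ck_mukai_cliff openU (0, basis_vec i) aC bC))) => x _.
by rewrite mxE.
Qed.

Lemma Ck_QB2 (U : set 'rV[R]_5) k (a b : 'rV[R]_5 -> form R 5) i : open U ->
  Ck k U a -> Ck k U b -> Ck k U (fun x => (QB (a x) (b x)).2 0 i).
Proof.
move=> openU aC bC.
apply: (Ck_ext openU _ (CkZ openU 2%:R (Ck_mukai_cliff openU (basis_vec i, 0) aC bC))) => x _.
by rewrite mxE.
Qed.

Lemma Ck_fquartic (U : set 'rV[R]_5) k (a b : 'rV[R]_5 -> form R 5) : open U ->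
  Ck k U a -> Ck k U b -> Ck k U (fun x => fquartic (a x, b x)).
Proof.
move=> openU aC bC.
have terms i : Ck k U (fun x => (QB (a x) (a x)).1 0 i * (QB (b x) (b x)).2 0 i +
    (QB (b x) (b x)).1 0 i * (QB (a x) (a x)).2 0 i).
  by apply: CkD => //; apply: CkM => //; [exact: Ck_QB1|exact: Ck_QB2|exact: Ck_QB1|exact: Ck_QB2].
by apply: (Ck_ext openU _ (CkZ openU 2%:R^-1 (Ck_bigsum openU (index_enum 'I_5) terms))) => x _;
  rewrite /fquartic ipE.
Qed.

End LocalGeometry.

Section OnManifolds.
Local Open Scope classical_set_scope.
Context {R : realType}.

Lemma transition_coord n (M : manifold R n) (i j : chart M) p : dom i p ->
  transition i j (coord i p) = coord j p.
Proof. by move=> ip; rewrite /transition coordK. Qed.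

Lemma ip_chart n (M : manifold R n) (v w : gsection M) (i j : chart M) p :
  dom i p -> dom j p ->
  ip (v i (coord i p)) (w i (coord i p)) = ip (v j (coord j p)) (w j (coord j p)).
Proof.
move=> di dj; have xij : overlap i j (coord i p) by exists p.
rewrite -(transition_coord (i := i) j di).
have c1 (u : gsection M) :
    (u i (coord i p)).1 *m jac i j (coord i p) = 1 *: (u j (transition i j (coord i p))).1.
  by rewrite scale1r (gvec_change1 u xij).
have c2 (u : gsection M) : (u i (coord i p)).2 =
    1 *: (u j (transition i j (coord i p))).2 *m (jac i j (coord i p))^T.
  by rewrite scale1r; exact: gvec_change2.
by rewrite (ip_natural (c1 v) (c2 v) (c1 w) (c2 w)) expr1n mul1r.
Qed.

(** A locally constant function is constant on connected sets; as the function is given chart by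
    chart, its levels are defined through any chart around the point. *)
Lemma constant_ip_local n (M : manifold R n) (v w : gsection M) :
  (forall (i : chart M) x, cimage i x ->
     \forall y \near x, ip (v i y) (w i y) = ip (v i x) (w i x)) ->
  constant_ip v w.
Proof.
move=> loc i j p q di dj [C [Cp _ connC] Cq].
pose level (P : set R) : set M :=
  [set r | exists2 k : chart M, dom k r & P (ip (v k (coord k r)) (w k (coord k r)))].
have level_open P : open (level P).
  rewrite openE => r [k dk Pr]; rewrite /interior.
  have dk_near : \forall s \near r, dom k s by apply: open_nbhs_nbhs; split=> //; exact: dom_open.
  have ck : cimage k (coord k r) by exists r.
  have eq_near : \forall s \near r, ip (v k (coord k s)) (w k (coord k s)) =
      ip (v k (coord k r)) (w k (coord k r)) by exact: (coord_continuous dk (loc k _ ck)).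
  near=> s; exists k; first by near: s.
  by rewrite (near eq_near s).
set c := ip (v i (coord i p)) (w i (coord i p)).
(* Values do not depend on the chart, so the level of c is the complement of the level of all other
   values. Both are open, hence the level of c is also closed. *)
have levelC : level [set c] = ~` level (~` [set c]).
  apply/seteqP; split=> r.
    move=> [k dk /= kc] [l dl /=]; apply; rewrite -kc; exact: ip_chart.
  move=> nr; have [k dk] := dom_cover r; exists k => //=.
  by apply: contrapT => nc; apply: nr; exists k.
have CE : C `&` level [set c] = C.
  apply: connC.
  - by exists p; split=> //; exists i.
  - by exists (level [set c]).
  - exists (level [set c]) => //; rewrite levelC; exact/open_closedC/level_open.
have : (C `&` level [set c]) q by rewrite CE.
by move=> [_ [k dk /= <-]]; exact: ip_chart.
Unshelve. all: by end_near. Qed.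

End OnManifolds.

Section CriticalPairs.
Local Open Scope classical_set_scope.
Context {R : realType}.

Lemma ip_inj n (u v : gvec R n) : (forall w, ip u w = ip v w) -> u = v.
Proof.
move=> uv; apply/eqP; rewrite -subr_eq0; apply/eqP; apply: ip_nondegenerate => w.
by rewrite ipDl ipNl uv subrr.
Qed.

(** A quadratic polynomial in z is fixed by its values at 0, 1 and -1; pairing with an arbitrary w
    makes the identities scalar. *)
Lemma generating_coefs (a b : form R 5) (p : R) (v1 h v2 : gvec R 5) :
  (forall z : R, Q (a + z *: b) = p *: (v1 + (2%:R * z) *: h + z ^+ 2 *: v2)) ->
  [/\ Q a = p *: v1, QB a b = p *: h & Q b = p *: v2].
Proof.
move=> gen; have H z w : ip (Q a) w + 2%:R * z * ip (QB a b) w + z ^+ 2 * ip (Q b) w =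
    p * (ip v1 w + 2%:R * z * ip h w + z ^+ 2 * ip v2 w).
  have := congr1 (fun u => ip u w) (gen z).
  by rewrite QD QZ QBZr !(ipDl, ipZl) => <-; ring.
by split; apply: ip_inj => w; rewrite ipZl; move: (H 0 w) (H 1 w) (H (-1) w);
  rewrite ?expr0n /=; nra.
Qed.

Context (M : manifold R 5) (rho1 rho2 : form_field M).
Hypotheses (M_oriented : oriented M)
  (rho_even : pointwise (fun (i : chart M) x => is_even2 (rho1 i x, rho2 i x)))
  (rho_stable : pointwise (fun (i : chart M) x => fquartic (rho1 i x, rho2 i x) != 0)).

Let f (i : chart M) x := fquartic (rho1 i x, rho2 i x).

(** One construction yields v_1, h and v_2. The factors det J of [QB] and of phi cancel in the
    quotient, and phi^-1 is smooth because f has no zero. *)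
Lemma normalized_section (a b : form_field M) : exists s : gsection M,
  forall (i : chart M) x, s i x = (phi (rho1 i x, rho2 i x))^-1 *: QB (a i x) (b i x).
Proof.
pose s (i : chart M) x := (phi (rho1 i x, rho2 i x))^-1 *: QB (a i x) (b i x).
have s_smooth i : smooth (cimage i) (s i).
  move=> k; have openU := @cimage_open _ _ M i.
  have q : Ck k (cimage i) (fun x => (phi (rho1 i x, rho2 i x))^-1).
    apply: Ck_invsqrt => //; first by move=> x; exact: rho_stable.
    by apply: Ck_fquartic => //; exact: form_smooth.
  apply: Ck_gvec => // l.
    apply: (Ck_ext openU _ (CkM openU q (Ck_QB1 l openU (form_smooth a i k) (form_smooth b i k)))).
    by move=> x _; rewrite /s /= [RHS]mxE.
  apply: (Ck_ext openU _ (CkM openU q (Ck_QB2 l openU (form_smooth a i k) (form_smooth b i k)))).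
  by move=> x _; rewrite /s /= [RHS]mxE.
have phiE i j x : overlap i j x -> [/\ phi (rho1 i x, rho2 i x) =
    \det (jac i j x) * phi (rho1 j (transition i j x), rho2 j (transition i j x)),
    \det (jac i j x) != 0 & phi (rho1 j (transition i j x), rho2 j (transition i j x)) != 0].
  move=> xij; have J0 := M_oriented xij; have J0' : \det (jac i j x) != 0 by rewrite gt_eqF.
  have pE : phi (rho1 i x, rho2 i x) =
    \det (jac i j x) * phi (rho1 j (transition i j x), rho2 j (transition i j x)).
    by rewrite (form_change rho1 xij) (form_change rho2 xij) phi_pullback.
  split=> //; have : phi (rho1 i x, rho2 i x) != 0.
    rewrite gt_eqF // phi_gt0 //; apply: rho_stable.
    by case: xij => r [di _] <-; exists r.
  by rewrite pE mulf_eq0 negb_or => /andP[].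
have s_change1 i j x : overlap i j x -> (s j (transition i j x)).1 = (s i x).1 *m jac i j x.
  move=> xij; have [pE d0 p0] := phiE i j x xij.
  rewrite /s /= -scalemxAl (form_change a xij) (form_change b xij) QB_pullback1.
  by rewrite scalerA pE invfM mulrAC mulVf // mul1r.
have s_change2 i j x : overlap i j x ->
    (s i x).2 = (s j (transition i j x)).2 *m (jac i j x)^T.
  move=> xij; have [pE d0 p0] := phiE i j x xij.
  have QE : (QB (a i x) (b i x)).2 = \det (jac i j x) *:
      (QB (a j (transition i j x)) (b j (transition i j x))).2 *m (jac i j x)^T.
    by rewrite (form_change a xij) (form_change b xij); exact: QB_pullback2.
  transitivity ((phi (rho1 i x, rho2 i x))^-1 *: (QB (a i x) (b i x)).2) => //.
  rewrite QE /s -[(_ *: _).2]/(_ *: (QB _ _).2).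
  by rewrite -!scalemxAl scalerA pE invfM mulrAC mulVf // mul1r.
by exists (GSection s_smooth s_change1 s_change2).
Qed.

Lemma generated_by_exists :
  exists v1 h v2 : gsection M, generated_by rho1 rho2 v1 h v2.
Proof.
have [v1 v1E] := normalized_section rho1 rho1.
have [h hE] := normalized_section rho1 rho2.
have [v2 v2E] := normalized_section rho2 rho2.
exists v1, h, v2 => i x xi z; rewrite v1E hE v2E QD QZ QBZr !QB_diag.
have p0 : phi (rho1 i x, rho2 i x) != 0 by rewrite gt_eqF // phi_gt0 //; exact: rho_stable.
have combine (p : R) (A B C : gvec R 5) : p != 0 -> A + 2%:R *: (z *: B) + z ^+ 2 *: C =
    p *: (p^-1 *: A + (2%:R * z) *: (p^-1 *: B) + z ^+ 2 *: (p^-1 *: C)).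
  move=> pn0; have pK k : p * k / p = k by rewrite mulrAC divff // mul1r.
  by rewrite !scalerDr !scalerA !pK divff // scale1r.
exact: combine.
Qed.

Variables (rhat1 rhat2 : form_field M).
Hypothesis rhatP : pointwise (fun (i : chart M) x =>
     is_hat (rho1 i x, rho2 i x) (rhat1 i x, rhat2 i x)).
Hypotheses (drho1 : closed_form rho1) (drho2 : closed_form rho2)
  (drhat1 : closed_form rhat1) (drhat2 : closed_form rhat2).
Variables (v1 h v2 : gsection M).
Hypothesis gen : generated_by rho1 rho2 v1 h v2.

Let gen_at (i : chart M) x : cimage i x ->
  [/\ Q (rho1 i x) = phi (rho1 i x, rho2 i x) *: v1 i x,
      QB (rho1 i x) (rho2 i x) = phi (rho1 i x, rho2 i x) *: h i x &
      Q (rho2 i x) = phi (rho1 i x, rho2 i x) *: v2 i x].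
Proof. by move=> xi; apply: generating_coefs => z; exact: gen. Qed.

Lemma generated_independent : independent v1 h v2.
Proof.
move=> i x xi; have [q1 q2 q3] := gen_at xi; have [/= e1 e2] := rho_even xi.
exact: (triple_free e1 e2 (rho_stable xi) q1 q2 q3).
Qed.

(** The factor k is the same in all charts; the remaining variation is carried by the sign of f,
    which is locally constant. *)
Let gram (v w : gsection M) (k : R) :=
  forall (i : chart M) x, cimage i x -> ip (v i x) (w i x) = k * Num.sg (f i x).

Let gram_table : [/\ gram v1 v1 0, gram v1 h 0, gram h v2 0, gram v2 v2 0 &
  gram v1 v2 1 /\ gram h h (- 2%:R^-1)].
Proof.
have G (i : chart M) x (xi : cimage i x) := let: And3 q1 q2 q3 := gen_at xi in
  triple_gram (proj1 (rho_even xi)) (proj2 (rho_even xi)) (rho_stable xi) q1 q2 q3.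
split; [| | | |split]; move=> i x xi; have [g1 g2 g3 g4 [g5 g6]] := G i x xi.
- by rewrite g1 mul0r.
- by rewrite g2 mul0r.
- by rewrite g3 mul0r.
- by rewrite g4 mul0r.
- by rewrite g5 mul1r.
- by rewrite g6 mulNr.
Qed.

Let near_chart (i : chart M) x : cimage i x -> \forall y \near x, cimage i y.
Proof. by move=> xi; apply: open_nbhs_nbhs; split=> //; exact: cimage_open. Qed.

Let sg_near (i : chart M) x : cimage i x -> \forall y \near x, Num.sg (f i y) = Num.sg (f i x).
Proof.
move=> xi; have fC : Ck 0 (cimage i) (f i).
  by apply: Ck_fquartic; [exact: cimage_open|exact: form_smooth|exact: form_smooth].
exact: (near_sgr (Ck_cvg fC xi) (rho_stable xi)).
Qed.

Let gram_near (v w : gsection M) k (i : chart M) x : gram v w k -> cimage i x ->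
  \forall y \near x, ip (v i y) (w i y) = ip (v i x) (w i x).
Proof.
move=> g xi; near=> y; rewrite (g i x xi) (g i y); last by near: y; exact: near_chart.
by congr (_ * _); near: y; exact: sg_near.
Unshelve. all: by end_near. Qed.

Lemma generated_constant_ip (v w : gsection M) :
  [\/ v = v1, v = h | v = v2] -> [\/ w = v1, w = h | w = v2] -> constant_ip v w.
Proof.
have [g1 g2 g3 g4 [g5 g6]] := gram_table.
have gramC p q k : gram p q k -> gram q p k by move=> g i x xi; rewrite ipC g.
move=> vE wE; suff [k vwk] : exists k, gram v w k.
  by apply: constant_ip_local => i x; exact: gram_near vwk.
by case: vE => ->; case: wE => ->; eexists; by [eassumption|apply: gramC; eassumption].
Qed.

Let partials_form (a : form_field M) (i : chart M) x : cimage i x -> all_partials (a i) x.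
Proof. by move=> xi; exact: (Ck_derivable (form_smooth a i 1) xi). Qed.

Let partials_gvec (v : gsection M) (i : chart M) x : cimage i x -> all_partials (v i) x.
Proof. by move=> xi; exact: (Ck_derivable (gvec_smooth v i 1) xi). Qed.

(* Near x every form built from the triple is a constant multiple of one of
   the closed forms rho, rhat. *)
Let closed_near (b : form_field M) (i : chart M) x (c : R -> R) (a : 'rV[R]_5 -> form R 5) :
  closed_form b -> cimage i x ->
  (forall y, cimage i y -> a y = c (Num.sg (f i y)) *: b i y) -> ext_d a x = 0.
Proof.
move=> db xi ab; apply: (ext_d_near (b := b i) (c := c (Num.sg (f i x)))).
- near=> y; rewrite ab; last by near: y; exact: near_chart.
  by congr (c _ *: _); near: y; exact: sg_near.
- exact: partials_form.
- exact: db.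
Unshelve. all: by end_near. Qed.

Let sg2 (i : chart M) x : cimage i x -> Num.sg (f i x) * Num.sg (f i x) = 1.
Proof. by move=> xi; rewrite -expr2 sqr_sg rho_stable. Qed.

(** The formulas for rhat are solved for the Clifford products: the sign of f is its own inverse,
    and the factor phi cancels against that of Q. *)
Let hat_at (i : chart M) x : cimage i x ->
  cliff (v1 i x) (rho2 i x) = - Num.sg (f i x) *: rhat1 i x /\
  cliff (v2 i x) (rho1 i x) = Num.sg (f i x) *: rhat2 i x.
Proof.
move=> xi; have [q1 q2 q3] := gen_at xi.
have p0 : phi (rho1 i x, rho2 i x) != 0 by rewrite gt_eqF // phi_gt0 //; exact: rho_stable.
have [/= h2 h1] := is_hatE (rho_even xi) (rho_stable xi) (rhatP xi).
split; apply: (scalerI p0); rewrite scalerA mulrC -scalerA.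
  by rewrite h1 -cliffZl -q1 scaleNr scalerN opprK scalerA sg2 // scale1r.
by rewrite h2 -cliffZl -q3 scalerA sg2 // scale1r.
Qed.

Lemma generated_courant :
  [/\ courant_commute v1 h, courant_commute v1 v2 & courant_commute h v2].
Proof.
have [g1 g2 g3 g4 [g5 g6]] := gram_table.
have C (i : chart M) x (xi : cimage i x) := let: And3 q1 q2 q3 := gen_at xi in
  triple_cliff (proj1 (rho_even xi)) (proj2 (rho_even xi)) (rho_stable xi) q1 q2 q3.
have W (i : chart M) x (xi : cimage i x) := let: And3 q1 q2 q3 := gen_at xi in
  triple_words (proj1 (rho_even xi)) (proj2 (rho_even xi)) (rho_stable xi) q1 q2 q3.
(* A vanishing product counts as 0 times a closed form, so [closed_near] covers it as well. *)
have d11 (i : chart M) x : cimage i x -> ext_d (fun y => cliff (v1 i y) (rho1 i y)) x = 0.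
  move=> xi; apply: (closed_near (c := fun=> 0) drho1 xi) => y yi.
  by have [-> _ _ _] := C i y yi; rewrite scale0r.
have d12 (i : chart M) x : cimage i x -> ext_d (fun y => cliff (v1 i y) (rho2 i y)) x = 0.
  move=> xi; apply: (closed_near (c := fun s => - s) drhat1 xi) => y yi.
  by have [-> _] := hat_at yi.
have d21 (i : chart M) x : cimage i x -> ext_d (fun y => cliff (v2 i y) (rho1 i y)) x = 0.
  move=> xi; apply: (closed_near (c := fun s => s) drhat2 xi) => y yi.
  by have [_ ->] := hat_at yi.
have d22 (i : chart M) x : cimage i x -> ext_d (fun y => cliff (v2 i y) (rho2 i y)) x = 0.
  move=> xi; apply: (closed_near (c := fun=> 0) drho2 xi) => y yi.
  by have [_ -> _ _] := C i y yi; rewrite scale0r.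
have dh1 (i : chart M) x : cimage i x -> ext_d (fun y => cliff (h i y) (rho1 i y)) x = 0.
  (* The coefficient composes h . rho_1 = - v_1 . rho_2 / 2 with v_1 . rho_2 = - e rhat_1. *)
  move=> xi; apply: (closed_near (c := fun s => - (2%:R^-1 * - s)) drhat1 xi) => y yi.
  by have [_ _ -> _] := C i y yi; have [-> _] := hat_at yi; rewrite scalerA scaleNr.
have dh2 (i : chart M) x : cimage i x -> ext_d (fun y => cliff (h i y) (rho2 i y)) x = 0.
  move=> xi; apply: (closed_near (c := fun s => - (2%:R^-1 * s)) drhat2 xi) => y yi.
  by have [_ _ _ ->] := C i y yi; have [_ ->] := hat_at yi; rewrite scalerA scaleNr.
have bracket0 (u w : gsection M) k (i : chart M) x (xi : cimage i x) (g : gram u w k) :=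
  @courant_eq0 _ (u i) (w i) (rho1 i) (rho2 i) x _
    (partials_gvec xi) (partials_gvec xi) (partials_form xi) (partials_form xi)
    (rho_stable xi) (gram_near g xi).
split=> i x xi; [apply: (bracket0 _ _ _ _ _ xi g2) | apply: (bracket0 _ _ _ _ _ xi g5)
  | apply: (bracket0 _ _ _ _ _ xi g3)].
(* In each of the three brackets only the double products remain; [triple_words] gives the multiple
   of rho_1 or rho_2 to which each is equal. *)
- move=> r [] ->; split; rewrite ?drho1 ?drho2 ?d11 ?d12 ?dh1 ?dh2 //.
    apply: (closed_near (c := fun=> 0) drho1 xi) => y yi.
    by have [-> _ _ _ _] := W i y yi; rewrite scale0r.
  apply: (closed_near (c := fun s => - s) drho1 xi) => y yi.
  by have [_ -> _ _ _] := W i y yi.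
- move=> r [] ->; split; rewrite ?drho1 ?drho2 ?d11 ?d12 ?d21 ?d22 //.
    apply: (closed_near (c := fun s => 2%:R * s) drho1 xi) => y yi.
    by have [_ _ -> _ _] := W i y yi.
  apply: (closed_near (c := fun=> 0) drho1 xi) => y yi.
  by have [_ _ _ -> _] := W i y yi; rewrite scale0r.
- move=> r [] ->; split; rewrite ?drho1 ?drho2 ?dh1 ?dh2 ?d21 ?d22 //.
    apply: (closed_near (c := fun s => s) drho2 xi) => y yi.
    by have [_ _ _ _ [-> _]] := W i y yi.
  apply: (closed_near (c := fun=> 0) drho1 xi) => y yi.
  by have [_ _ _ _ [_ ->]] := W i y yi; rewrite scale0r.
Qed.

End CriticalPairs.

End Development.

Theorem proposition4 (R : realType) (M : manifold R 5)
  (M_compact : compact [set: M]%classic)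
  (M_oriented : oriented M)
  (rho1 rho2 : form_field M)
  (rho_even : pointwise (fun (i : chart M) x => is_even2 (rho1 i x, rho2 i x)))
  (rho_open_orbit :
     pointwise (fun (i : chart M) x => in_open_orbit (rho1 i x, rho2 i x)))
  (rhat1 rhat2 : form_field M)
  (rhatP : pointwise (fun (i : chart M) x =>
     is_hat (rho1 i x, rho2 i x) (rhat1 i x, rhat2 i x)))
  (drho1 : closed_form rho1) (drho2 : closed_form rho2)
  (drhat1 : closed_form rhat1) (drhat2 : closed_form rhat2) :
  (exists v1 h v2 : gsection M, generated_by rho1 rho2 v1 h v2) /\
  (forall v1 h v2 : gsection M, generated_by rho1 rho2 v1 h v2 ->
     [/\ independent v1 h v2,
         [/\ courant_commute v1 h, courant_commute v1 v2 &
             courant_commute h v2] &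
         forall v w : gsection M,
           [\/ v = v1, v = h | v = v2] -> [\/ w = v1, w = h | w = v2] ->
           constant_ip v w]).
Proof.
(* The open-orbit hypothesis is converted here into f <> 0, the form in which the constructions and
   brackets use it. *)
have stable : pointwise (fun (i : chart M) x =>
    is_true (fquartic (rho1 i x, rho2 i x) != GRing.zero)).
  by move=> i x xi; apply: open_orbit_neq0; [exact: rho_even|exact: rho_open_orbit].
split; first exact: generated_by_exists.
move=> v1 h v2 gen; split.
- exact: (generated_independent rho_even stable gen).
- exact: (generated_courant rho_even stable rhatP drho1 drho2 drhat1 drhat2 gen).
- by move=> v w; exact: (generated_constant_ip rho_even stable gen).
Qed.
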